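(* Let $1\le b\le m$ be integers and let $U=\{u_1\le u_2\le\dots\le u_b\}\subset(0,1)$ be inverse bike speeds with $u_b>T(m,U)$ and $u_{b-1}\le T_1(m,U)$ (the first condition forces $b\ge2$). Then the algorithm $\mathrm{AllButOne}$ on input $(m,U)$ solves the Relaxed Bike Sharing problem optimally: the schedule $(X,M)$ it outputs is feasible and $\tau(X,M)\le\tau(X',M')$ for every feasible schedule $(X',M')$ (with any number of bikes abandoned).
   Context: There are $m$ agents and $b$ bikes, all starting at the point $0$ of the interval $[0,1]$. Bike $k$ has inverse speed $u_k$; label $0$ denotes walking, with inverse speed $1$. A schedule of size $n$ is a pair $(X,M)$, where $X=(x_1,\dots,x_n)$ satisfies $x_j\ge 0$ and $\sum_j x_j=1$ (consecutive subintervals of $[0,1]$ and their lengths), and $M$ is an $m\times n$ matrix with entries in $\{0,1,\dots,b\}$; $M(i,j)$ is the label of the bike used by agent $i$ on subinterval $x_j$ ($0$ if agent $i$ walks). Let $\widetilde M(i,j)=u_{M(i,j)}$ if $M(i,j)\ne 0$ and $\widetilde M(i,j)=1$ if $M(i,j)=0$. Put $t_{i,j}=\sum_{k=1}^{j}\widetilde M(i,k)x_k$, $t_i=t_{i,n}$, and $\tau(X,M)=\max_i t_i$. $(X,M)$ is feasible if: (1) for $j\ge2$, $M(i,j)\ne0$ implies there is $i'$ with $M(i',j-1)=M(i,j)$; (2) $M(i,j)\ne 0$ implies $M(i',j)\ne M(i,j)$ for all $i'\ne i$; (3) for $j\ge 2$, $M(i,j)=M(i',j-1)\neq0$ implies $t_{i',j-1}\le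 t_{i,j-1}$. The Relaxed Bike Sharing problem asks for a feasible schedule minimizing $\tau$; bikes need not be used all the way to the end (they may be abandoned). Quantities. $T(m,U)=1-\frac1m\sum_{j=1}^b(1-u_j)$; for $Y=[y_1,\dots,y_b]\in[0,1]^b$, $T(m,U,Y)=1-\frac1m\sum_{k=1}^b(1-u_k)y_k$; and $T_1(m,U)=\min_{0\le y\le1}\max\{T(m,U,[1,\dots,1,y]),\,yu_b+(1-y)u_1\}$. Also $m_k=m-b+k$ and $U_k=\{u_1,\dots,u_k\}$. Optimal partition. For a schedule matrix $M$ satisfying (1) and (2), the associated linear program in variables $\tau,x_1,\dots,x_n$ is: minimize $\tau$ subject to $\tau\ge t_i$ for all $i$; $t_{i',j-1}\le t_{i,j-1}$ whenever $M(i,j)=M(i',j-1)\ne0$, $i\ne i'$; $x_j\ge0$; $\sum_jx_j=1$. $\mathrm{AllMakeIt}(m,U)$ (for $b=0$ or $u_b\le T(m,U)$): if $b=0$, the matrix is the $m\times1$ zero column. If $b\ge1$, the matrix is the concatenation, left to right, of: for $j=1,\dots,m-b$, a single column whose entry in row $i$ is $i-j+1$ if $j\le i\le j+b-1$ and $0$ otherwise; then, for $k=0,\dots,b-1$, a block whose rows $1,\dots,m_k$ form the matrix of $\mathrm{AllMakeIt}(m_k,U_k)$ and whose row $i$, for $m_k<i\le m$, has all entries equal to $i-(m-b)$ (when $m=b$ the block $k=0$ is a single column with no rows coming from the recursive call). $\mathrm{AllButOne}(m,U)$: let $q$ be the largest index in $\{1,\dots,b\}$ with $u_q\le T(m_q,U_q)$.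 The matrix $M$ is the concatenation of $b-q+1$ blocks. In block $1$, rows $1,\dots,m_q$ form the matrix of $\mathrm{AllMakeIt}(m_q,U_q)$, and row $i$ for $m_q<i\le m$ is constantly $i-(m-b)$. In block $j$, $2\le j\le b-q+1$, rows $1,\dots,m_{q+j-2}$ form the matrix of $\mathrm{AllMakeIt}(m_{q+j-2},\{u_2,\dots,u_{q+j-2}\})$ (with bikes keeping their original labels $2,\dots,q+j-2$), row $i$ for $m_{q+j-1}\le i\le m-1$ is constantly $i-(m-b)$, and row $m$ is constantly $1$. $X$ is the $X$-part of an optimal solution of the linear program associated with $M$. *)

(* Defs.v *)
From HB Require Import structures.
From mathcomp Require Import all_boot all_order all_algebra.
From mathcomp Require Import reals.
From mathcomp Require Import ring lra zify.

Set Implicit Arguments.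
Unset Strict Implicit.
Unset Printing Implicit Defensive.

Import Order.TTheory GRing.Theory Num.Theory.

(* A column of a schedule matrix is given as a function from row numbers
   1, ..., m to labels; its values outside 1, ..., m are irrelevant. *)

(* [c] in rows 1, ..., m0 and [d] in the rows below. *)
Definition stack (m0 : nat) (c d : nat -> nat) : nat -> nat :=
  fun i => if i <= m0 then c i else d i.

(* The recursive calls are on b' < b bikes, so that depth [h = b] suffices:
   see [all_make_itE] for the intended recursive equation. *)
Fixpoint all_make_it_rec (h s m b : nat) : seq (nat -> nat) :=
  if h is h'.+1 then
    if b == 0 then [:: fun=> 0] else
      [seq (fun i => if j <= i <= j + b - 1 then s + (i - j + 1) else 0)
         | j <- iota 1 (m - b)]
      ++ flatten
           [seq [seq stack (m - b + k) c (fun i => s + (i - (m - b)))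
                   | c <- all_make_it_rec h' s (m - b + k) k]
              | k <- iota 0 b]
  else [:: fun=> 0].

(* The columns of the AllMakeIt matrix for m agents and the b bikes with
   labels s + 1, ..., s + b; the matrix does not depend on the speeds. *)
Definition all_make_it (s m b : nat) : seq (nat -> nat) :=
  all_make_it_rec b s m b.

Lemma all_make_it_rec_depth h h' s m b :
  b <= h -> b <= h' -> all_make_it_rec h s m b = all_make_it_rec h' s m b.
Proof.
elim: h h' m b => [|h IHh] [|h'] m b //=.
- by rewrite leqn0 => /eqP ->.
- by move=> _; rewrite leqn0 => /eqP ->.
move=> bh bh'; case: eqP => // _; congr (_ ++ flatten _).
apply/eq_in_map => k; rewrite mem_iota add0n /= => kb.
by rewrite (IHh h') // -ltnS; exact: leq_trans kb _.
Qed.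

Lemma all_make_itE s m b :
  all_make_it s m b =
  if b == 0 then [:: fun=> 0] else
    [seq (fun i => if j <= i <= j + b - 1 then s + (i - j + 1) else 0)
       | j <- iota 1 (m - b)]
    ++ flatten
         [seq [seq stack (m - b + k) c (fun i => s + (i - (m - b)))
                 | c <- all_make_it s (m - b + k) k]
            | k <- iota 0 b].
Proof.
case: b => [//|b]; rewrite {1}/all_make_it.
apply: (congr1 (fun z => _ ++ flatten z)).
apply/eq_in_map => k; rewrite mem_iota add0n /= ltnS => kb.
by congr (map _ _); exact: all_make_it_rec_depth.
Qed.

Local Open Scope ring_scope.

Section Definitions.
Variable R : realType.

(* Inverse speeds are given by [u : nat -> R]: bike k has inverse speed [u k]
   for 1 <= k <= b, other values of [u] are irrelevant.  The set
   U_k = {u_1, ..., u_k} is thus represented by [u] with k in place of b. *)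
Implicit Types (m b n : nat) (u : nat -> R).

Definition inv_speed u (l : nat) : R := if l == 0%N then 1 else u l.

Section Schedules.
Variables (m b n : nat) (u : nat -> R).
Implicit Types (X : 'rV[R]_n) (M : 'M['I_b.+1]_(m, n)).

(* t_(i,j), the time at which agent i completes the first j subintervals.
   Subintervals are numbered from 1 in t_(i,j), and columns from 0. *)
Definition time X M (i : 'I_m) (j : nat) : R :=
  \sum_(k < n | (k < j)%N) inv_speed u (M i k) * X 0 k.

Definition arrival X M (i : 'I_m) : R := time X M i n.

(* Arrival times are nonnegative, so that 0 does not affect the maximum. *)
Definition tau X M : R := \big[Num.max/0]_(i < m) arrival X M i.

Definition is_partition X : Prop :=
  (forall j, 0 <= X 0 j) /\ \sum_j X 0 j = 1.

Definition bikes_available M : Prop :=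
  forall (i : 'I_m) (j j' : 'I_n), j = j'.+1 :> nat -> M i j != ord0 ->
    exists i', M i' j' = M i j.

Definition bikes_not_shared M : Prop :=
  forall (i i' : 'I_m) (j : 'I_n), M i j != ord0 -> i' != i -> M i' j != M i j.

(* If [j] stands for the (j+1)-th subinterval, [time X M i j] is the time at
   which agent i enters it. *)
Definition bikes_on_time X M : Prop :=
  forall (i i' : 'I_m) (j j' : 'I_n), j = j'.+1 :> nat ->
    M i j = M i' j' -> M i j != ord0 -> time X M i' j <= time X M i j.

Definition feasible X M : Prop :=
  [/\ is_partition X, bikes_available M, bikes_not_shared M
    & bikes_on_time X M].

Definition lp_feasible M (t : R) X : Prop :=
  [/\ forall i, arrival X M i <= t,
      forall (i i' : 'I_m) (j j' : 'I_n), j = j'.+1 :> nat ->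
        M i j = M i' j' -> M i j != ord0 -> i != i' ->
        time X M i' j <= time X M i j,
      forall j, 0 <= X 0 j
    & \sum_j X 0 j = 1].

Definition lp_optimal M (t : R) X : Prop :=
  lp_feasible M t X /\ forall t' X', lp_feasible M t' X' -> t <= t'.

End Schedules.

Definition T m b u : R := 1 - m%:R^-1 * \sum_(1 <= j < b.+1) (1 - u j).

Definition TY m b u (y : nat -> R) : R :=
  1 - m%:R^-1 * \sum_(1 <= k < b.+1) (1 - u k) * y k.

Definition T1_objective m b u (y : R) : R :=
  Num.max (TY m b u (fun k => if k == b then y else 1))
          (y * u b + (1 - y) * u 1%N).

Definition is_T1 m b u (t : R) : Prop :=
  (exists2 y, 0 <= y <= 1 & T1_objective m b u y = t) /\
  (forall y, 0 <= y <= 1 -> t <= T1_objective m b u y).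

(* The default value 0 of the maximum is not reached: k = 1 always
   qualifies, because m_1 >= 1 and u_1 < 1. *)
Definition abo_index m b u : nat :=
  (\max_(1 <= k < b.+1 | (u k <= T (m - b + k)%N k u)%R) k)%N.

Definition abo_columns m b u : seq (nat -> nat) :=
  let q := abo_index m b u in
  let mm k := (m - b + k)%N in
  [seq stack (mm q) c (fun i => (i - (m - b))%N) | c <- all_make_it 0 (mm q) q]
  ++ flatten
       [seq [seq stack (mm (q + j - 2)%N) c
                   (fun i => if (i < m)%N then (i - (m - b))%N else 1%N)
               | c <- all_make_it 1 (mm (q + j - 2)%N) (q + j - 3)]
          | j <- iota 2 (b - q)].

(* All the labels are at most b, so that [inord] does not alter them. *)
Definition abo_matrix m b u : 'M['I_b.+1]_(m, size (abo_columns m b u)) :=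
  \matrix_(i, j) inord (nth (fun=> 0%N) (abo_columns m b u) j i.+1).

Definition abo_output m b u (X : 'rV[R]_(size (abo_columns m b u))) : Prop :=
  exists t, lp_optimal u (abo_matrix m b u) t X.

Lemma is_T1_exists m b u : (1 <= b)%N -> u 1%N <= u b -> u b <= 1 ->
  exists t, is_T1 m b u t.
Proof.
move=> b1 u1b ub1.
pose A := m%:R^-1 * \sum_(1 <= k < b) (1 - u k).
pose B := m%:R^-1 * (1 - u b).
have B0 : 0 <= B by rewrite mulr_ge0 ?invr_ge0 ?ler0n ?subr_ge0.
have objE y : T1_objective m b u y =
    Num.max (1 - (A + B * y)) (y * u b + (1 - y) * u 1%N).
  congr (Num.max (1 - _) _); rewrite big_nat_recr //= eqxx mulrDr mulrA.
  congr (m%:R^-1 * _ + _); apply: eq_big_nat => k /andP[_ kb].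
  by rewrite ltn_eqF // mulr1.
have [f1|f1] := leP (u b) (1 - (A + B)).
  exists (1 - (A + B)); split.
    by exists 1; rewrite ?ler01 ?lexx // objE mulr1 mul1r subrr mul0r addr0; apply/max_idPl.
  by move=> y /andP[y0 y1]; rewrite objE le_max; apply/orP; left; nra.
have [f0|f0] := leP (1 - A) (u 1%N).
  exists (u 1%N); split.
    by exists 0; rewrite ?ler01 ?lexx // objE mulr0 mul0r addr0 add0r subr0 mul1r; apply/max_idPr.
  by move=> y /andP[y0 y1]; rewrite objE le_max; apply/orP; right; nra.
pose D := B + (u b - u 1%N).
have D0 : 0 < D by rewrite /D; lra.
pose z := (1 - A - u 1%N) / D.
have zD : z * D = 1 - A - u 1%N by rewrite divfK // gt_eqF.
have z0 : 0 <= z by rewrite divr_ge0 ?ltW // subr_gt0.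
have z1 : z <= 1 by rewrite ler_pdivrMr // mul1r /D; lra.
have fg : 1 - (A + B * z) = z * u b + (1 - z) * u 1%N.
  by move: zD; rewrite /D; lra.
exists (1 - (A + B * z)); split; first by exists z; rewrite ?z0 // objE -fg maxxx.
move=> y /andP[y0 y1]; rewrite objE le_max; apply/orP.
have [yz|zy] := leP y z; [left; nra|right; rewrite fg; nra].
Qed.

End Definitions.

Arguments abo_output {R} m b u X.

(* Main.v *)
(* Lower bound.  If bike b is used on a length y, then the mean arrival time is
   at least T(m, U, [1, ..., 1, y]), and some agent needs at least the time
   y u_b + (1 - y) u_1, because bike b only passes to agents who arrive later.
   Hence T_1(m, U) <= tau for every feasible schedule, and it suffices to find
   a feasible point of value T_1(m, U) of the linear program; no existence
   theorem for optimal solutions is needed.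

   Construction.  The two expressions above agree for some y, which becomes the
   length of block 1.  In AllMakeIt(m, U), the first m - b columns and block 0
   are shifts of a single column, so that synchronizing agents 1, ..., m - b + 1
   at the end of block 0 is a triangular system, with a nonnegative solution
   because the bikes are sorted.  It is scaled so that agent m, who then rides
   bike b up to 1, arrives at the mean time.  From there on, a synchronized
   group moves as in the AllMakeIt schedules of the blocks and absorbs the next
   agent at the point where it meets him; each meeting point is the root of an
   affine function, and comparing mean times shows that it lies before 1, and
   equals 1 for the last agent.  The blocks 2, ..., b - q + 1 of AllButOne are
   another instance of this, with agent m on bike 1 as the last one to join. *)

Require Import Defs.
From mathcomp Require Import all_boot all_order all_algebra.
From mathcomp Require Import reals.
From mathcomp Require Import ring lra zify.

Set Implicit Arguments.
Unset Strict Implicit.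
Unset Printing Implicit Defensive.

Import Order.TTheory GRing.Theory Num.Theory.
Local Open Scope ring_scope.

Ltac nlia :=
  repeat match goal with
  | H : forall _, _ |- _ => clear H
  | H : context [@Order.le] |- _ => clear H
  | H : context [@Order.lt] |- _ => clear H
  | H : @eq ?A _ _ |- _ =>
      assert_fails (unify A nat); assert_fails (unify A bool); clear H
  end; lia.

Lemma all_flatten (A : Type) (a : pred A) (ss : seq (seq A)) :
  all a (flatten ss) = all (all a) ss.
Proof. by elim: ss => //= s ss <-; exact: all_cat. Qed.

(** * Columns described by the bikes ridden in them *)

Section Rides.
Variables (R : realType) (u : nat -> R).
Implicit Types (m g n : nat) (c d : nat -> nat) (ls : seq nat).

(** Only the multiset of nonzero labels is recorded. This determines the total pace of a column and
    suffices for availability and non-sharing, while the rows of the riders stay open. *)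
Definition rides m c ls : bool :=
  perm_eq [seq l <- [seq c i | i <- iota 1 m] | l != 0%N] ls.

Definition load ls : R := \sum_(l <- ls) (1 - u l).

Lemma rides_mem m c ls i :
  rides m c ls -> (0 < i <= m)%N -> c i != 0%N -> c i \in ls.
Proof.
move=> /perm_mem <- im ci0; rewrite mem_filter ci0 /=.
by apply: map_f; rewrite mem_iota; nlia.
Qed.

Lemma rides_ex m c ls l :
  rides m c ls -> l \in ls -> exists2 i, (0 < i <= m)%N & c i = l.
Proof.
move=> /perm_mem <-; rewrite mem_filter => /andP[_ /mapP[i]].
by rewrite mem_iota => im ->; exists i => //; nlia.
Qed.

Lemma uniq_map_inj (A B : eqType) (f : A -> B) (t : seq A) :
  uniq (map f t) -> {in t &, injective f}.
Proof.
elim: t => //= a t IHt /andP[fat ft] x y.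
rewrite !inE => /predU1P[-> | xt] /predU1P[-> | yt] // fxy; last exact: IHt.
- by rewrite fxy map_f in fat.
- by rewrite -fxy map_f in fat.
Qed.

Lemma rides_inj m c ls i i' : rides m c ls -> uniq ls ->
  (0 < i <= m)%N -> (0 < i' <= m)%N -> c i != 0%N -> c i = c i' -> i = i'.
Proof.
move=> /perm_uniq <-; rewrite filter_map => cU im i'm ci0 cii'.
apply: (uniq_map_inj cU) => //.
all: by rewrite mem_filter mem_iota /= -?cii' ci0; nlia.
Qed.

(** Walkers contribute nothing to the sum of [1 - inv_speed], so only the ridden bikes remain. *)
Lemma rides_sum m c ls : rides m c ls ->
  \sum_(1 <= i < m.+1) inv_speed u (c i) = m%:R - load ls.
Proof.
move=> cls; suff: \sum_(1 <= i < m.+1) (1 - inv_speed u (c i)) = load ls.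
  by move=> <-; rewrite sumrB sumr_const_nat subSS subn0 opprB addrC subrK.
rewrite /load -(perm_big _ cls) big_filter big_map /index_iota subSS subn0 /=.
rewrite [RHS]big_mkcond; apply: eq_bigr => i _; rewrite /inv_speed.
by case: eqP => //=; rewrite subrr.
Qed.

Lemma rides_stack g n c d ls :
  rides g c ls -> (forall i, (g < i <= g + n)%N -> d i != 0%N) ->
  rides (g + n) (stack g c d) (ls ++ [seq d i | i <- iota g.+1 n]).
Proof.
move=> cls d0; rewrite /rides iotaD map_cat filter_cat.
apply: perm_cat.
  rewrite (_ : map _ _ = map c (iota 1 g)) //.
  by apply/eq_in_map => i; rewrite mem_iota /stack => ig; rewrite ifT //; nlia.
rewrite add1n (_ : map _ _ = map d (iota g.+1 n)).
  rewrite (all_filterP _) //; apply/allP => _ /mapP[i + ->].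
  by rewrite mem_iota => ig; apply: d0; nlia.
by apply/eq_in_map => i; rewrite mem_iota /stack => ig; rewrite ifF //; nlia.
Qed.

Lemma rides_ext m c c' ls : (forall i, (0 < i <= m)%N -> c i = c' i) ->
  rides m c ls -> rides m c' ls.
Proof.
move=> cc'; rewrite /rides (_ : map c _ = map c' (iota 1 m)) //.
by apply/eq_in_map => i; rewrite mem_iota => im; apply: cc'; nlia.
Qed.

End Rides.

(** * Trips: travelling a list of columns while tracking the times of all agents *)

Section Trips.
Variables (R : realType) (u : nat -> R).
Implicit Types (m g n : nat) (p c d : nat -> nat) (s : nat -> R).
Implicit Types (cs : seq (nat -> nat)) (ls : seq nat) (L x a k : R).

Definition advance s c x : nat -> R := fun i => s i + x * inv_speed u (c i).

(* Agents may pass from the column [p] to the column [c] if agent [i] reaches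
   the boundary at time [s i]. *)
Definition handover m p c s : Prop :=
  forall i i', (0 < i <= m)%N -> (0 < i' <= m)%N ->
    c i = p i' -> c i != 0%N -> s i' <= s i.

(* After the column [p], agents at the times [s] can travel the columns [cs],
   of suitable lengths with sum [L], so as to finish at the times [s']. *)
Fixpoint trip m p s cs L s' : Prop :=
  if cs is c :: cs' then
    exists x, [/\ 0 <= x, handover m p c s
                & trip m c (advance s c x) cs' (L - x) s']
  else L = 0 /\ forall i, (0 < i <= m)%N -> s i = s' i.

Lemma handover0 m c s : handover m (fun=> 0%N) c s.
Proof. by move=> i i' _ _ -> /eqP. Qed.

Lemma trip_ext m p s1 s2 s1' s2' cs L :
  (forall i, (0 < i <= m)%N -> s1 i = s2 i) ->
  (forall i, (0 < i <= m)%N -> s1' i = s2' i) ->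
  trip m p s1 cs L s1' -> trip m p s2 cs L s2'.
Proof.
move=> s12 s12'; elim: cs p s1 s2 s12 L => /= [|c cs IHcs] p s1 s2 s12 L.
  by move=> [L0 ss]; split=> // i im; rewrite -s12 // -s12' // ss.
move=> [x [x0 pc cs1]]; exists x; split=> //.
  by move=> i i' im i'm; rewrite -!s12 //; exact: pc.
by apply: IHcs cs1 => i im; rewrite /advance s12.
Qed.

Lemma trip_cat m p s s' s'' cs cs' L L' :
  trip m p s cs L s' -> trip m (last p cs) s' cs' L' s'' ->
  trip m p s (cs ++ cs') (L + L') s''.
Proof.
move=> + tr'; elim: cs p s L tr' => /= [|c cs IHcs] p s L tr'.
  by move=> [-> ss]; rewrite add0r; apply: trip_ext tr' => // i im; rewrite ss.
move=> [x [x0 pc /IHcs trc]]; exists x; split=> //.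
by rewrite addrAC; exact: trc.
Qed.

(** Handovers only compare times, so affine maps of nonnegative slope preserve them. A trip from
    time 0 on length 1 can thus be replayed on any length after a synchronized start. *)
Lemma trip_affine m p s s' cs L a k : 0 <= k -> trip m p s cs L s' ->
  trip m p (fun i => a + k * s i) cs (k * L) (fun i => a + k * s' i).
Proof.
move=> k0; elim: cs p s L => /= [|c cs IHcs] p s L.
  by move=> [-> ss]; rewrite mulr0; split=> // i /ss ->.
move=> [x [x0 pc /IHcs trc]]; exists (k * x); split.
- exact: mulr_ge0.
- by move=> i i' im i'm cp c0; rewrite lerD2l ler_wpM2l // (pc i).
- rewrite -mulrBr; apply: trip_ext trc => // i _.
  by rewrite /advance mulrDr addrA mulrA.
Qed.

Lemma handover_stack m g p c d s ls :
  uniq [seq d i | i <- iota g.+1 (m - g)] ->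
  (forall i, (g < i <= m)%N -> d i != 0%N /\ d i \notin ls) ->
  rides g p ls -> rides g c ls ->
  handover g p c s -> handover m (stack g p d) (stack g c d) s.
Proof.
move=> dU dls pls cls pc i i' im i'm; rewrite /stack.
case: leqP => ig; case: leqP => i'g.
- by apply: pc; nlia.
- move=> ci ci0; have /dls[_] : (g < i' <= m)%N by nlia.
  by rewrite -ci (rides_mem cls) //; nlia.
- move=> di di0; have /dls[_] : (g < i <= m)%N by nlia.
  by rewrite di (rides_mem pls) -?di //; nlia.
- move=> dd _; rewrite (uniq_map_inj dU (x := i) (y := i')) //.
  all: by rewrite mem_iota; nlia.
Qed.

(** Inside the block the agents below row [g] keep their bikes, none of which is in [ls], so
    handovers reduce to those of the upper group. Only the first boundary, after the arbitrary
    column [p], takes a hypothesis of its own. *)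
Lemma trip_stack m g p s s' cs L d q ls (S : nat -> R) :
  (g <= m)%N -> uniq [seq d i | i <- iota g.+1 (m - g)] ->
  (forall i, (g < i <= m)%N -> d i != 0%N /\ d i \notin ls) ->
  all (rides g ^~ ls) cs ->
  (forall c, rides g c ls -> handover g q c s ->
     handover m p (stack g c d) S) ->
  (forall i, (0 < i <= g)%N -> s i = S i) ->
  trip g q s cs L s' ->
  trip m p S [seq stack g c d | c <- cs] L
    (fun i => if (i <= g)%N then s' i else S i + L * inv_speed u (d i)).
Proof.
move=> gm dU dls; elim: cs p q s S L => /= [|c cs IHcs] p q s S L.
  move=> _ _ sS [-> ss]; split=> // i im; rewrite mul0r addr0.
  by case: leqP => // ig; rewrite -sS ?ss //; nlia.
move=> /andP[cls csls] pq sS [x [x0 qc trc]]; exists x; split=> //.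
  exact: pq.
have trc' := IHcs (stack g c d) c _ (advance S (stack g c d) x) _ csls _ _ trc.
apply: trip_ext (trc' _ _) => //.
- move=> i im; case: leqP => // ig.
  by rewrite /advance /stack leqNgt ig /=; ring.
- move=> c' c'ls cc'.
  apply: (handover_stack dU dls) => // i i' im i'm.
  move=> /(cc' i i' im i'm) + c'0 => /(_ c'0).
  by rewrite /advance /stack !ifT ?sS //; nlia.
- by move=> i ig; rewrite /advance /stack ifT ?sS //; nlia.
Qed.

Lemma trip_map m p s (c : nat -> nat -> nat) (z : nat -> R) n :
  let st j i := s i + \sum_(0 <= l < j) z l * inv_speed u (c l i) in
  (forall j, (j < n)%N -> 0 <= z j) ->
  handover m p (c 0%N) s ->
  (forall j, (j.+1 < n)%N -> handover m (c j) (c j.+1) (st j.+1)) ->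
  trip m p s [seq c j | j <- iota 0 n] (\sum_(0 <= j < n) z j) (st n).
Proof.
move=> st; elim: n => [|n IHn] z0 pc0 pc.
  by rewrite /= big_geq //; split=> // i _; rewrite /st big_geq // addr0.
rewrite -[X in iota _ X]addn1 iotaD map_cat big_nat_recr //=.
apply: (trip_cat (s' := st n)).
  apply: IHn => // j jn; [apply: z0|apply: pc]; nlia.
exists (z n); split; first exact: z0.
- case: n {IHn z0} pc => [|n] pc.
    by move=> i i' im i'm ci c0; rewrite /st !big_geq // !addr0; exact: (pc0 i).
  by rewrite -[X in iota _ X]addn1 iotaD map_cat last_cat; exact: pc.
- split; first by rewrite subrr.
  by move=> i _; rewrite /advance /st big_nat_recr //= addrA.
Qed.

(** All columns have the same total pace, so the sum of the times grows at a constant rate, whatever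
    the lengths. *)
Lemma trip_sum m p s s' cs L ls : all (rides m ^~ ls) cs ->
  trip m p s cs L s' ->
  \sum_(1 <= i < m.+1) s' i =
  \sum_(1 <= i < m.+1) s i + L * (m%:R - load u ls).
Proof.
elim: cs p s L => /= [|c cs IHcs] p s L.
  move=> _ [-> ss]; rewrite mul0r addr0; apply: eq_big_nat => i im.
  by rewrite ss.
move=> /andP[cls csls] [x [_ _ /IHcs -> //]].
by rewrite big_split /= -mulr_sumr (rides_sum _ cls); ring.
Qed.

End Trips.

(** * Synchronized groups that absorb further agents *)

Section CatchUp.
Variables (R : realType) (u : nat -> R).
Implicit Types (m g n : nat) (p c d : nat -> nat).

(** The difference of the two affine functions changes sign on [[0, L]]. If [w <= w'], the
    hypotheses force equality at [L]. *)
Lemma affine_meet (a a' w w' L : R) :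
  0 <= L -> a <= a' -> a' + L * w' <= a + L * w ->
  exists2 x, 0 <= x <= L & a + x * w = a' + x * w'.
Proof.
move=> L0 aa' ee'; have [ww'|w'w] := leP w w'.
  by exists L; [rewrite L0 lexx | nra].
have D0 : w - w' != 0 by rewrite subr_eq0 gt_eqF.
exists ((a' - a) / (w - w')); last by field.
by rewrite divr_ge0 ?subr_ge0 ?(ltW w'w) // ler_pdivrMr ?subr_gt0 //; lra.
Qed.

Lemma affine_le (a a' w w' x L : R) : 0 <= x <= L ->
  a <= a' -> a + L * w <= a' + L * w' -> a + x * w <= a' + x * w'.
Proof. by move=> /andP[x0 xL]; have [|] := leP w w'; nra. Qed.

Lemma homo_range (f : nat -> R) g m i j :
  (forall k, (g < k < m)%N -> f k <= f k.+1) ->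
  (g < i <= j)%N -> (j <= m)%N -> f i <= f j.
Proof.
move=> fS /andP[gi]; elim: j => [|j IHj]; first by nlia.
rewrite leq_eqVlt => /predU1P[-> // | ij] jm.
by apply: le_trans (IHj _ _) (fS _ _); nlia.
Qed.

(** A bike taken over from the group comes from an agent who arrives no later than anyone; a bike
    from a lower row can only stay with its rider. *)
Lemma handover_synced m g p c d ls (s : nat -> R) : rides g c ls ->
  (forall i i', (0 < i <= m)%N -> (0 < i' <= g)%N -> s i' <= s i) ->
  (forall i', (g < i' <= m)%N -> p i' \notin ls) ->
  (forall i i', (g < i <= m)%N -> (g < i' <= m)%N -> d i = p i' -> i = i') ->
  handover m p (stack g c d) s.
Proof.
move=> cls sg pls dp i i' im i'm; have [i'g _ _|gi'] := leqP i' g.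
  by apply: sg => //; nlia.
rewrite /stack; case: leqP => ig ci ci0.
  by have := pls i'; rewrite -ci (rides_mem cls) //; nlia.
by rewrite (dp i i') //; nlia.
Qed.

Lemma last_stack g p d ls (cs : seq (nat -> nat)) :
  cs <> [::] -> all (rides g ^~ ls) cs ->
  exists2 c, rides g c ls & last p [seq stack g c d | c <- cs] = stack g c d.
Proof.
case: cs => // c cs _; elim: cs c => [|c' cs IHcs] c /=; rewrite ?andbT.
  by exists c.
by move=> /andP[_ /IHcs].
Qed.

Lemma trip_block m g p (S : nat -> R) (cs : seq (nat -> nat)) x a v d ls :
  (g <= m)%N -> uniq [seq d i | i <- iota g.+1 (m - g)] ->
  (forall i, (g < i <= m)%N -> d i != 0%N /\ d i \notin ls) ->
  all (rides g ^~ ls) cs ->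
  (forall c, rides g c ls -> handover m p (stack g c d) S) ->
  0 <= x -> (forall i, (0 < i <= g)%N -> S i = a) ->
  trip u g (fun=> 0%N) (fun=> 0) cs 1 (fun=> v) ->
  trip u m p S [seq stack g c d | c <- cs] x
    (fun i => if (i <= g)%N then a + x * v else S i + x * inv_speed u (d i)).
Proof.
move=> gm dU dls csls pc x0 Sa /(trip_affine a x0); rewrite mulr1 => trx.
apply: (trip_stack gm dU dls csls _ _ trx); first by move=> c /pc.
by move=> i /Sa ->; rewrite mulr0 addr0.
Qed.

(* Agents 1, ..., g start together at the time [a], and the agents below
   follow, each of them keeping to the bike [d i].  The group of the first h
   agents moves as prescribed by [B h] until agent h + 1, met at the root of
   an affine function, joins it.  The agents end at the times [e i] if they
   always keep to their bikes; the identity for the sum of the final times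
   places the last meeting at the very end of the trip. *)
Lemma catch_up r g m p (S : nat -> R) L a (B : nat -> seq (nat -> nat))
    (ls : nat -> seq nat) (w : nat -> R) (d : nat -> nat) :
  let e i := S i + L * inv_speed u (d i) in
  (0 < g)%N -> m = (g + r.+1)%N -> 0 <= L ->
  uniq [seq d i | i <- iota g.+1 (m - g)] ->
  (forall i, (g < i <= m)%N -> d i != 0%N) ->
  (forall h i, (g <= h < i)%N -> (i <= m)%N -> d i \notin ls h) ->
  (forall h, (g <= h < m)%N ->
     [/\ B h <> [::], all (rides h ^~ (ls h)) (B h)
       & trip u h (fun=> 0%N) (fun=> 0) (B h) 1 (fun=> w h / h%:R)]) ->
  (forall h, (g <= h)%N -> (h.+1 < m)%N ->
     w h.+1 = w h + inv_speed u (d h.+1)) ->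
  (forall i, (0 < i <= g)%N -> S i = a) -> a <= S g.+1 ->
  (forall i, (g < i < m)%N -> S i <= S i.+1) ->
  (forall i, (g < i < m)%N -> e i <= e i.+1) ->
  m%:R * e m = g%:R * a + L * w g + \sum_(g.+1 <= i < m.+1) e i ->
  (forall c, rides g c (ls g) -> handover m p (stack g c d) S) ->
  trip u m p S (flatten [seq [seq stack h c d | c <- B h] | h <- iota g r.+1])
    L (fun=> e m).
Proof.
elim: r g p S L a => [|r IHr] g p S L a e g0 mE L0 dU d0 dls BP wS Sa aS SS eS
  eE pc.
  have gm : (g <= g < m)%N by nlia.
  have [_ Bls Btrip] := BP _ gm.
  have g0' : g%:R != 0 :> R by rewrite pnatr_eq0 -lt0n.
  have gS : m = g.+1 by nlia.
  rewrite /= cats0.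
  apply: (@trip_ext _ _ _ _ S S (fun i => if (i <= g)%N
    then a + L * (w g / g%:R) else S i + L * inv_speed u (d i))) => // [i im|].
    case: leqP => ig; last by rewrite /e (_ : m = i) //; nlia.
    (* Only agent [m] is left, so the identity for the sum says that the group also ends at
       [e m]. *)
    move: eE; rewrite gS big_nat1 -natr1 => eE.
    have -> : a + L * (w g / g%:R) = (g%:R * a + L * w g) / g%:R by field.
    by rewrite (_ : g%:R * a + L * w g = e g.+1 * g%:R) ?mulfK //; lra.
  apply: (trip_block _ dU _ Bls pc) => //; first by nlia.
  by move=> i ig; rewrite d0 ?dls //; nlia.
have gm : (g <= g < m)%N by nlia.
have [B0 Bls Btrip] := BP _ gm.
have g0' : 0 < g%:R :> R by rewrite ltr0n.
(* No [e i] exceeds [e m], so by the identity the group, left to itself, would end no earlier than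
   [e m]. Hence it meets agent [g + 1] within the length [L]. *)
have meet : S g.+1 + L * inv_speed u (d g.+1) <= a + L * (w g / g%:R).
  have eg j : (g < j <= m)%N -> e j <= e m.
    by move=> gj; apply: (homo_range eS); nlia.
  have le_sum : \sum_(g.+1 <= i < m.+1) e i <= (m - g)%:R * e m.
    rewrite -subSS mulr_natl -sumr_const_nat.
    by apply: ler_sum_nat => i gi; apply: eg; nlia.
  have -> : a + L * (w g / g%:R) = (g%:R * a + L * w g) / g%:R.
    by field; rewrite gt_eqF.
  rewrite ler_pdivlMr // -/(e g.+1).
  have : e g.+1 <= e m by apply: eg; nlia.
  rewrite natrB in le_sum; last by nlia.
  nra.
have [x /andP[x0 xL] xE] := affine_meet L0 aS meet.
rewrite (_ : iota g r.+2 = g :: iota g.+1 r.+1) // map_cons.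
rewrite -[X in trip _ _ _ _ _ X](subrKC x) [flatten _]/=.
(* The times at the meeting point. For the lower agents, keeping to their bikes from there leads to
   the same final times [e]. *)
pose S' i := if (i <= g)%N
  then a + x * (w g / g%:R) else S i + x * inv_speed u (d i).
have S'e i : (g < i)%N -> S' i + (L - x) * inv_speed u (d i) = e i.
  by move=> gi; rewrite /S' leqNgt gi /e /=; ring.
have S'a i : (0 < i <= g.+1)%N -> S' i = a + x * (w g / g%:R).
  move=> ig; rewrite /S'; case: leqP => // gi.
  by rewrite xE (_ : i = g.+1) //; nlia.
have S'S i : (g < i < m)%N -> S' i <= S' i.+1.
  move=> ig; rewrite /S' !ifF; [|nlia..].
  by apply: (affine_le _ (SS i ig) (eS i ig)); rewrite x0.
apply: (trip_cat (s' := S')).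
  apply: (trip_block _ dU _ Bls pc) => //; first by nlia.
  by move=> i ig; rewrite d0 ?dls //; nlia.
rewrite -(S'e m); last by nlia.
apply: (IHr g.+1 _ S' (L - x) (a + x * (w g / g%:R))) => //.
- by nlia.
- by rewrite subr_ge0.
- move: dU; rewrite (_ : (m - g)%N = (m - g.+1).+1); last by nlia.
  by case/andP.
- by move=> i ig; apply: d0; nlia.
- by move=> h i hi; apply: dls; nlia.
- by move=> h hm; apply: BP; nlia.
- by move=> h hm; apply: wS; nlia.
- by rewrite -(S'a g.+1) ?S'S //; nlia.
- by move=> i ig; apply: S'S; nlia.
- by move=> i ig; rewrite !S'e; [apply: eS | |]; nlia.
(* The identity persists: the pace of agent [g + 1] passes from the sum over the lower agents into
   [w g.+1]. *)
- rewrite S'e; last by nlia.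
  rewrite (eq_big_nat _ _ (F2 := e)); last by move=> i ig; apply: S'e; nlia.
  have := eE; rewrite (big_ltn (m := g.+1)); last by nlia.
  rewrite wS; [|nlia..].
  move=> ->; set sum := \sum_(_ <= _ < _) _; rewrite /e -natr1.
  have gE : g%:R * (w g / g%:R) = w g by rewrite mulrC divfK // gt_eqF.
  move: xE gE; set v := w g / _ => xE gE.
  by rewrite -gE; lra.
move=> c cls.
have [c0 c0ls ->] := last_stack p d B0 Bls.
apply: (handover_synced cls).
- move=> i i' im i'g; rewrite [S' i']S'a //.
  have [ig|gi] := leqP i g.+1; first by rewrite S'a //; nlia.
  by rewrite -(S'a g.+1); [apply: (homo_range S'S) |]; nlia.
- by move=> i' i'm; rewrite /stack ifF ?dls //; nlia.
- move=> i i' ig i'g; rewrite /stack [X in if X then _ else _]leqNgt.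
  rewrite (_ : (g < i')%N) /=; last by nlia.
  by move=> dd; apply: (uniq_map_inj dU) => //; rewrite mem_iota; nlia.
Qed.

End CatchUp.

(** * The columns of AllMakeIt *)

Lemma map_iota_shift s n k r :
  [seq (s + (i - n))%N | i <- iota (n + k).+1 r] = iota (s + k).+1 r.
Proof.
rewrite -addnS iotaDl -map_comp -addnS [RHS]iotaDl.
by apply: eq_map => i /=; nlia.
Qed.

(** With [m] agents, these are the initial columns of AllMakeIt for [j < m - b] and its block 0 for
    [j = m - b], which makes both cases shifts of one column. *)
Definition window s b j : nat -> nat :=
  fun i => if (j < i <= j + b)%N then (s + (i - j))%N else 0%N.

Lemma rides_window s m b j : (j + b <= m)%N ->
  rides m (window s b j) (iota s.+1 b).
Proof.
move=> jbm; have -> : m = (j + (b + (m - j - b)))%N by nlia.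
rewrite /rides !iotaD !map_cat !filter_cat.
have nil k r : (forall i, (k <= i < k + r)%N -> window s b j i = 0%N) ->
    [seq l <- [seq window s b j i | i <- iota k r] | l != 0%N] = [::].
  move=> w0; apply/eqP; rewrite -(negbK (_ == _)) -has_filter -all_predC.
  by apply/allP => _ /mapP[i + ->] /=; rewrite mem_iota negbK => ik; rewrite w0.
rewrite nil ?[X in _ ++ _ ++ X]nil ?cats0.
all: try by move=> i; rewrite /window; case: ifP; nlia.
rewrite add1n (_ : map _ _ = iota (s + 0).+1 b); last first.
  rewrite -(map_iota_shift s j 0 b) addn0; apply/eq_in_map => i.
  by rewrite mem_iota /window => ij; rewrite ifT //; nlia.
rewrite addn0; have /all_filterP -> // : all (fun l => l != 0%N) (iota s.+1 b).
by apply/allP => l; rewrite mem_iota; nlia.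
Qed.

Lemma all_make_it_neq0 s m b : all_make_it s m b <> [::].
Proof. by rewrite all_make_itE; case: b => //= b; case: map. Qed.

(** In block [k] the recursive call uses the first [k] bikes and the rows below use the others. *)
Lemma all_make_it_rides s m b : (b <= m)%N ->
  all (rides m ^~ (iota s.+1 b)) (all_make_it s m b).
Proof.
elim/ltn_ind: b m => b IHb m bm; rewrite all_make_itE; case: eqP => [->|b0] /=.
  by rewrite andbT /rides (_ : filter _ _ = [::]) //; elim: iota.
rewrite all_cat all_map; apply/andP; split.
  apply/allP => j; rewrite mem_iota => jm /=.
  apply: (rides_ext _ (@rides_window s m b j.-1 _)); last by nlia.
  by move=> i im; rewrite /window; do 2 case: ifP; nlia.
rewrite all_flatten all_map; apply/allP => k; rewrite mem_iota => kb /=.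
rewrite all_map.
apply: sub_all (IHb k _ (m - b + k)%N _) => [c ck /=||]; [|nlia..].
have -> : iota s.+1 b = iota s.+1 k ++
    [seq (s + (i - (m - b)))%N | i <- iota (m - b + k).+1 (b - k)].
  by rewrite map_iota_shift -addSn -iotaD subnKC //; nlia.
rewrite [in rides m](_ : m = m - b + k + (b - k))%N; last by nlia.
by apply: rides_stack ck _ => i; nlia.
Qed.

(* Solving the triangular system keeps the z j nonnegative because v is
   nonincreasing. *)
Lemma convolution_inverse (R : realFieldType) (v : nat -> R) n :
  0 < v 0%N -> (forall k, v k.+1 <= v k) ->
  exists2 z : nat -> R, forall j, 0 <= z j
    & forall i, (i <= n)%N -> \sum_(0 <= j < i.+1) z j * v (i - j)%N = 1.
Proof.
move=> v0 vS; elim: n => [|n [z z0 zv]].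
  exists (fun=> (v 0%N)^-1); first by move=> _; rewrite invr_ge0 ltW.
  by move=> i; rewrite leqn0 => /eqP ->; rewrite big_nat1 mulVf // gt_eqF.
pose r := 1 - \sum_(0 <= j < n.+1) z j * v (n.+1 - j)%N.
exists (fun j => if j == n.+1 then r / v 0%N else z j) => [j | i].
  case: eqP => // _; rewrite divr_ge0 ?(ltW v0) // subr_ge0 -(zv n) //.
  by apply: ler_sum_nat => k kn; rewrite ler_wpM2l // subSn //; nlia.
rewrite leq_eqVlt => /predU1P[->|i_n].
  rewrite big_nat_recr //= eqxx subnn divfK ?gt_eqF //.
  rewrite (eq_big_nat _ _ (F2 := fun j => z j * v (n.+1 - j)%N)) ?subrKC //.
  by move=> j jn; rewrite ltn_eqF.
rewrite -(zv i) //; apply: eq_big_nat => j ji; rewrite ifF //; nlia.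
Qed.

(** * Travel times of AllMakeIt *)

Section MakeIt.
Variables (R : realType) (u : nat -> R) (N : nat).
Hypothesis u01 : forall k, (1 <= k <= N)%N -> 0 < u k < 1.
Hypothesis u_sorted : forall j k, (1 <= j <= k)%N -> (k <= N)%N -> u j <= u k.

(** Below row [j] come the bikes from fastest to slowest and then walkers, who are slower than any
    bike. *)
Lemma window_speed s b j i : (s + b <= N)%N -> (j < i)%N ->
  inv_speed u (window s b j i) <= inv_speed u (window s b j i.+1).
Proof.
move=> sbN ji; rewrite /window ji (leqW ji) /=.
rewrite /inv_speed; case: (leqP i (j + b)) => ib; last first.
  by rewrite [(i.+1 <= _)%N]leqNgt (ltn_trans ib).
rewrite ifF; last by nlia.
case: ltnP => ib' /=; last first.
  by have /andP[_ /ltW] : 0 < u (s + (i - j))%N < 1 by apply: u01; nlia.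
rewrite ifF; last by nlia.
by apply: u_sorted; nlia.
Qed.

(** If [v k] is the time that row [k + 1] of the first window saves against walking per unit length,
    then window [j] saves [v (i - j)] in row [i + 1]. Equal savings in the first [n + 1] rows thus
    form a convolution equation, whose solution is divided by its sum to get length 1. *)
Lemma window_trip s n b (c : nat -> nat -> nat) : (0 < b)%N -> (s + b <= N)%N ->
  (forall j i, (j <= n)%N -> (0 < i <= n + b)%N -> c j i = window s b j i) ->
  exists P : nat -> R,
  [/\ forall i, (0 < i <= n.+1)%N -> P i = P n.+1,
      forall i, (n < i)%N -> P i <= P i.+1
    & trip u (n + b) (fun=> 0%N) (fun=> 0) [seq c j | j <- iota 0 n.+1] 1 P].
Proof.
move=> b0 sbN cw.
pose v k := 1 - inv_speed u (window s b 0 k.+1).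
have v0 : 0 < v 0%N.
  rewrite /v /window ifT; last by nlia.
  rewrite subn0 addn1 /inv_speed /= subr_gt0.
  by have /andP[] : 0 < u s.+1 < 1 by apply: u01; nlia.
have vS k : v k.+1 <= v k.
  by rewrite /v; have := @window_speed s b 0 k.+1 sbN isT; lra.
have [z z0 zv] := convolution_inverse n v0 vS.
pose Z := \sum_(0 <= j < n.+1) z j.
have Z0 : 0 < Z.
  have : 1 <= Z * v 0%N.
    rewrite -(zv n) // /Z mulr_suml; apply: ler_sum_nat => j _.
    rewrite ler_wpM2l //; elim: (n - j)%N => // k; exact: le_trans.
  by move=> /(lt_le_trans ltr01); rewrite pmulr_lgt0.
have Z1 : \sum_(0 <= j < n.+1) z j / Z = 1.
  by rewrite -mulr_suml divff ?gt_eqF.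
pose P i := \sum_(0 <= j < n.+1) z j / Z * inv_speed u (window s b j i).
have PE i : (i <= n)%N -> P i.+1 = 1 - Z^-1.
  move=> i_n; suff: 1 - P i.+1 = Z^-1 by lra.
  rewrite -[1 in LHS]Z1 /P -sumrB (big_cat_nat (n := i.+1)) //=.
  rewrite [X in _ + X = _](_ : _ = 0) ?addr0; last first.
    rewrite big_nat big1 // => j jn.
    by rewrite /window ifF ?mulr1 ?subrr //; nlia.
  rewrite -[RHS]mul1r -(zv i i_n) mulr_suml; apply: eq_big_nat => j ji.
  rewrite /v (_ : window s b 0 (i - j).+1 = window s b j i.+1); last first.
    by rewrite /window; do 2 case: ifP; nlia.
  by field; rewrite gt_eqF.
exists P; split.
- by move=> [|i] // ig; rewrite !PE //; nlia.
- move=> i ni; apply: ler_sum_nat => j jn; rewrite ler_wpM2l //.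
    by rewrite divr_ge0 // ltW.
  by apply: window_speed => //; nlia.
rewrite -[X in trip _ _ _ _ _ X]Z1.
have tr :=
  @trip_map _ u (n + b) (fun=> 0%N) (fun=> 0) c (fun j => z j / Z) n.+1.
apply: trip_ext (tr _ _ _) => // [i im | j _ |].
- by rewrite add0r; apply: eq_big_nat => j jn; rewrite cw //; nlia.
- by rewrite divr_ge0 // ltW.
(* From one window to the next a bike passes from a row to the one just below, which has been at
   least as slow in every window so far. *)
move=> j jn i i' im i'm; rewrite !cw // => [ii' w0|]; last by nlia.
have [iE ji'] : i = i'.+1 /\ (j < i')%N.
  by move: ii' w0; rewrite /window; do 2 case: ifP; nlia.
rewrite {i}iE in im ii' w0 *; rewrite !add0r; apply: ler_sum_nat => l lj.
rewrite !cw; [|nlia..].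
rewrite ler_wpM2l ?divr_ge0 ?(ltW Z0) //.
by apply: window_speed => //; nlia.
Qed.

(** The sum of the inverse speeds in a column where these bikes are ridden; for [s = 0] it is [m]
    times T(m, U). *)
Definition total_pace s m b : R := m%:R - load u (iota s.+1 b).

Lemma total_paceS s m b :
  total_pace s m.+1 b.+1 = total_pace s m b + u (s + b.+1)%N.
Proof.
rewrite /total_pace /load -[X in iota _ X]addn1 iotaD big_cat big_seq1 /=.
by rewrite -natr1 addSnnS; ring.
Qed.

Lemma total_pace_sum s n b k : (k <= b)%N ->
  total_pace s (n + b) b = total_pace s (n + k) k +
    \sum_((n + k).+1 <= i < (n + b).+1) u (s + (i - n))%N.
Proof.
move=> kb; rewrite -(subnKC kb); elim: (b - k)%N => [|r IHr].
  by rewrite addn0 big_geq // addr0.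
rewrite !addnS total_paceS IHr [in RHS]big_nat_recr /=; last by nlia.
by rewrite -addrA; congr (_ + (_ + u _)); nlia.
Qed.

(** If the slowest bike is at most at the mean pace, this remains so after it is removed together
    with its rider, and the next bike is no slower. The hypothesis of AllMakeIt thus passes to its
    recursive calls. *)
Lemma total_pace_ge s n b k : (s + b <= N)%N -> (0 < k <= b)%N ->
  (n + b)%:R * u (s + b)%N <= total_pace s (n + b) b ->
  (n + k)%:R * u (s + k)%N <= total_pace s (n + k) k.
Proof.
move=> + /andP[k0]; elim: b => [|b IHb]; first by nlia.
move=> sbN; rewrite leq_eqVlt => /predU1P[-> // | kb].
rewrite addnS total_paceS -natr1 => le_b.
apply: IHb => //; first by nlia.
have : u (s + b)%N <= u (s + b.+1)%N by apply: u_sorted; nlia.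
have : 0 <= (n + b)%:R :> R by exact: ler0n.
nra.
Qed.

Lemma all_make_it_trip s m b :
  (0 < m)%N -> (b <= m)%N -> (s + b <= N)%N ->
  ((0 < b)%N -> m%:R * u (s + b)%N <= total_pace s m b) ->
  trip u m (fun=> 0%N) (fun=> 0) (all_make_it s m b) 1
    (fun=> total_pace s m b / m%:R).
Proof.
elim/ltn_ind: b m => b IHb m m0 bm sbN slow.
have m0' : m%:R != 0 :> R by rewrite pnatr_eq0 -lt0n.
rewrite all_make_itE; case: eqP => [b0 | /eqP b0].
  exists 1; split=> [||/=]; [exact: ler01 | exact: handover0 |].
  rewrite subrr; split=> // i im.
  by rewrite /advance add0r mul1r /total_pace b0 /load big_nil subr0 divff.
have {b0} : (0 < b)%N by rewrite lt0n.
case: b => // b in IHb bm sbN slow * => _.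
set n := (m - b.+1)%N; have mE : m = (n + b.+1)%N by nlia.
pose d i := (s + (i - n))%N.
pose c j := if (j < n)%N then
    fun i =>
      if (j.+1 <= i <= j.+1 + b.+1 - 1)%N then (s + (i - j.+1 + 1))%N else 0%N
  else stack n (fun=> 0%N) d.
pose B h := all_make_it s h (h - n).
(* Block 0 joins the windows as the column [j = n]; a later block [k] is indexed by its group size
   [h = n + k]. *)
set cols := _ ++ _; have {cols}-> : cols = [seq c j | j <- iota 0 n.+1] ++
    flatten [seq [seq stack h c' d | c' <- B h] | h <- iota n.+1 b].
  rewrite /cols (_ : iota 0 n.+1 = iota 0 n ++ [:: n]); last first.
    by rewrite -addn1 iotaD.
  rewrite map_cat -catA; congr (_ ++ _).
    rewrite (iotaDl 1 0) -map_comp; apply/eq_in_map => j.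
    by rewrite mem_iota /c => jn /=; rewrite ifT //; nlia.
  rewrite /= /c ltnn addn0; congr (_ :: flatten _).
  rewrite -(addn1 n) (iotaDl n 1) -map_comp; apply/eq_in_map => k.
  rewrite mem_iota => kb /=.
  by rewrite /B addKn.
have cw j i : (j <= n)%N -> (0 < i <= n + b.+1)%N -> c j i = window s b.+1 j i.
  move=> jn im; rewrite /c /window; case: ltnP => jn'.
    by do 2 case: ifP; nlia.
  by rewrite /stack /d; do 2 case: ifP; nlia.
have [P [Pn PS trP]] := window_trip (ltn0Sn b) sbN cw.
rewrite -mE in trP.
pose W := total_pace s m b.+1.
have sumP : \sum_(1 <= i < m.+1) P i = W.
  rewrite (trip_sum (ls := iota s.+1 b.+1) _ trP) ?big1 ?add0r ?mul1r //.
  rewrite all_map; apply/allP => j; rewrite mem_iota => jn /=.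
  apply: (rides_ext _ (@rides_window s m b.+1 j _)) => [i im|]; last by nlia.
  by rewrite cw //; nlia.
(* With a single bike, [n + 1 = m]: the windows already synchronize all agents, and their common
   time is the mean. *)
have [b0|b0] := posnP b.
  rewrite [in iota n.+1 b]b0 cats0; apply: trip_ext trP => // i im.
  have PE j : (0 < j <= m)%N -> P j = P n.+1 by move=> jm; apply: Pn; nlia.
  rewrite PE //; apply: (mulfI m0'); rewrite mulrCA divff // mulr1 -/W -sumP.
  rewrite (eq_big_nat _ _ (F2 := fun=> P n.+1)) => [|j jm]; last exact: PE.
  by rewrite sumr_const_nat subSS subn0 mulr_natl.
have P_mono i j : (n < i <= j)%N -> (j <= m)%N -> P i <= P j.
  by apply: homo_range => k /andP[nk _]; exact: PS.
have W_le : W <= m%:R * P m.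
  rewrite -sumP (_ : _ * _ = \sum_(1 <= i < m.+1) P m); last first.
    by rewrite sumr_const_nat subSS subn0 mulr_natl.
  apply: ler_sum_nat => i im; have [i_n|ni] := leqP i n.+1.
    rewrite Pn; last by nlia.
    by apply: P_mono; nlia.
  by apply: P_mono; nlia.
have uT : m%:R * u (s + b.+1)%N <= W by exact: slow.
set v := u (s + b.+1)%N in uT *.
have m_gt0 : 0 < m%:R :> R by rewrite ltr0n.
(* The windows get the total length [x] for which agent [m], then riding the last bike, arrives at
   the mean time. Riding that bike all the way is no later than the mean, and the windows alone are
   no earlier. *)
have [x /andP[x0 x1] xE] : exists2 x, 0 <= x <= 1 &
    v + x * (P m - v) = W / m%:R + x * 0.
  have vW : v <= W / m%:R by rewrite ler_pdivlMr // mulrC.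
  have WP : W / m%:R <= P m by rewrite ler_pdivrMr // mulrC.
  by apply: affine_meet; lra.
have {}xE : x * P m + (1 - x) * v = W / m%:R by lra.
rewrite -[X in trip _ _ _ _ _ X](subrKC x).
have := trip_affine 0 x0 trP; rewrite mulr1 => trx.
have {}trx : trip u m (fun=> 0%N) (fun=> 0) [seq c j | j <- iota 0 n.+1] x
    (fun i => x * P i).
  by apply: trip_ext trx => i _; rewrite ?mulr0 add0r.
apply: (trip_cat trx).
have du i : (n < i <= m)%N -> inv_speed u (d i) = u (d i).
  by move=> im; rewrite /inv_speed ifF // /d; nlia.
have dm : v = inv_speed u (d m) by rewrite du ?/d /v; [congr u |]; nlia.
rewrite -xE dm.
have [r bE] : exists r, b = r.+1 by exists b.-1; nlia.
rewrite {1}bE.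
pose w h := total_pace s h (h - n).
have wS h : (n < h)%N -> (h < m)%N -> w h.+1 = w h + inv_speed u (d h.+1).
  move=> nh hm; rewrite du; last by nlia.
  by rewrite /w subSn 1?ltnW // total_paceS /d subSn 1?ltnW.
have wm : w n.+1 + \sum_(n.+2 <= i < m.+1) inv_speed u (d i) = W.
  have := @total_pace_sum s n b.+1 1 isT; rewrite -mE addn1 -/W => ->.
  rewrite /w subSnn; congr (_ + _).
  by apply: eq_big_nat => i im; rewrite du //; nlia.
apply: (@catch_up _ u r n.+1 m _ (fun i => x * P i) (1 - x) (x * P n.+1) B
  (fun h => iota s.+1 (h - n)) w d) => //.
- by nlia.
- by rewrite subr_ge0.
- by rewrite -{1}[n.+1]addn1 map_iota_shift iota_uniq.
- by move=> i im; rewrite /d; nlia.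
- by move=> h i hi im; rewrite mem_iota /d; nlia.
- move=> h hm; split; first exact: all_make_it_neq0.
    by apply: all_make_it_rides; nlia.
  apply: IHb; [nlia.. | move=> h0].
  have := @total_pace_ge s n b.+1 (h - n) sbN; rewrite subnKC; last by nlia.
  by rewrite -mE; apply; [nlia | exact: slow].
- by move=> h nh hm; apply: wS; nlia.
- by move=> i im /=; rewrite Pn.
- by rewrite ler_wpM2l ?PS.
- by move=> i im /=; rewrite ler_wpM2l ?PS //; nlia.
- move=> i im /=; apply: lerD; first by rewrite ler_wpM2l ?PS //; nlia.
  rewrite ler_wpM2l ?subr_ge0 // !du; [|nlia..].
  by apply: u_sorted; rewrite /d; nlia.
- rewrite -dm xE mulrC divfK // big_split /= -!mulr_sumr.
  have PE : n.+1%:R * P n.+1 + \sum_(n.+2 <= i < m.+1) P i = W.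
    rewrite -sumP [in RHS](big_cat_nat (n := n.+2)) //=; last by nlia.
    congr (_ + _); rewrite (eq_big_nat _ _ (F2 := fun=> P n.+1)).
      by rewrite sumr_const_nat subSS subn0 mulr_natl.
    by move=> i im; apply: Pn; nlia.
  have -> : W = x * W + (1 - x) * W by ring.
  by rewrite -{1}PE -wm; ring.
move=> c' c'ls.
have cnE i : (n.+1 < i <= m)%N -> c n i = d i.
  by move=> im; rewrite cw /window /d ?ifT //; nlia.
rewrite (_ : last _ _ = c n); last first.
  by rewrite -[n.+1]addn1 iotaD map_cat last_cat.
apply: (handover_synced c'ls).
- move=> i i' im i'n; rewrite ler_wpM2l // [P i']Pn //.
  have [i_n|ni] := leqP i n.+1; first by rewrite Pn //; nlia.
  by apply: P_mono; nlia.
- by move=> i' im; rewrite cnE // mem_iota /d; nlia.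
- by move=> i i' im i'm; rewrite cnE // /d; nlia.
Qed.

End MakeIt.

(** * The lower bound for arbitrary feasible schedules *)

Section LowerBound.
Variables (R : realType) (u : nat -> R) (m b n : nat).
Hypothesis bm : (1 <= b <= m)%N.
Hypothesis u01 : forall k, (1 <= k <= b)%N -> 0 < u k < 1.
Hypothesis u_sorted : forall j k, (1 <= j <= k)%N -> (k <= b)%N -> u j <= u k.
Variables (X : 'rV[R]_n) (M : 'M['I_b.+1]_(m, n)).

Lemma inv_speed_ge (l : 'I_b.+1) : u 1%N <= inv_speed u l.
Proof.
rewrite /inv_speed; case: eqP => l0; last first.
  by apply: u_sorted; have := ltn_ord l; nlia.
by have /andP[_ /ltW] : 0 < u 1%N < 1 by apply: u01; nlia.
Qed.

Lemma inv_speed_gt0 (l : 'I_b.+1) : 0 < inv_speed u l.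
Proof.
apply: lt_le_trans (inv_speed_ge l).
by have /andP[] : 0 < u 1%N < 1 by apply: u01; nlia.
Qed.

Lemma timeS i j : time u X M i j.+1 =
  time u X M i j + \sum_(k < n | k == j :> nat) inv_speed u (M i k) * X 0 k.
Proof.
rewrite /time (bigID (fun k : 'I_n => k == j :> nat)) addrC /=.
by congr (_ + _); apply: eq_bigl => k; nlia.
Qed.

Lemma arrivalE i : arrival u X M i = \sum_j inv_speed u (M i j) * X 0 j.
Proof. by apply: eq_bigl => j; rewrite ltn_ord. Qed.

Lemma arrival_le_tau i : arrival u X M i <= tau u X M.
Proof. exact: le_bigmax. Qed.

(** Each bike saves time for at most one agent. The bound grants the full saving to all bikes but
    bike [b], whose label is [ord_max]. *)
Lemma column_pace (j : 'I_n) : bikes_not_shared M ->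
  m%:R - \sum_(1 <= k < b) (1 - u k)
    - [exists i, M i j == ord_max]%:R * (1 - u b) <=
  \sum_(i < m) inv_speed u (M i j).
Proof.
move=> notshared.
have -> : \sum_(i < m) inv_speed u (M i j) =
    m%:R - \sum_(i < m) (1 - inv_speed u (M i j)).
  by rewrite sumrB sumr_const card_ord opprB addrC subrK.
rewrite -addrA -opprD lerB //.
pose v l := 1 - inv_speed u l.
pose taken k := [exists i, M i j == k :> nat].
have v0 k : (k <= b)%N -> 0 <= v k.
  rewrite /v /inv_speed subr_ge0; case: eqP => // k0 kb.
  by have /andP[_ /ltW] : 0 < u k < 1 by apply: u01; nlia.
have -> : \sum_(i < m) (1 - inv_speed u (M i j)) =
    \sum_(l < b.+1) (taken l)%:R * v l.
  (* Rows are grouped by label: walkers save nothing, and a nonzero label occurs in at most one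
     row. *)
  rewrite (partition_big (fun i => M i j) xpredT) //=; apply: eq_bigr => l _.
  have [l0|l0] := eqVneq l ord0.
    rewrite l0 /v subrr mulr0 big1 // => i /eqP ->.
    by rewrite subrr.
  have [/existsP[i /eqP/val_inj il]|/existsPn no] := boolP (taken l).
    rewrite (bigD1 i) ?il //= big1 ?addr0 ?mul1r // => i' /andP[/eqP il' ii'].
    by have := notshared i i' j; rewrite il il' eqxx => /(_ l0 ii').
  by rewrite mul0r big_pred0 // => i; exact/negbTE/no.
have vE k : (0 < k)%N -> 1 - u k = v k.
  by rewrite /v /inv_speed; case: k.
rewrite -(big_mkord xpredT (fun l => (taken l)%:R * v l)) big_ltn //.
rewrite [v 0%N]/v subrr mulr0 add0r big_nat_recr /=; last by nlia.
apply: lerD; last by rewrite vE //; nlia.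
apply: ler_sum_nat => k kb; rewrite vE; last by nlia.
by rewrite ler_piMl ?lern1 ?leq_b1 // v0 //; nlia.
Qed.

(* The second conjunct makes the induction work: on a column where bike b is
   used, the bound passes to its rider from the previous rider. *)
Lemma bike_b_schedule : feasible u X M ->
  let used j := [exists i, M i j == ord_max] in
  let lag j :=
    \sum_(k < n | (k < j)%N) (if used k then u b else u 1%N) * X 0 k in
  forall j, (j <= n)%N ->
    (exists i, lag j <= time u X M i j) /\
    forall i (k : 'I_n), j = k.+1 -> M i k = ord_max -> lag j <= time u X M i j.
Proof.
move=> [[X0 X1] avail notshared ontime] used lag.
elim=> [|j IHj] jn.
  split=> //; have m0 : (0 < m)%N by nlia.
  by exists (Ordinal m0); rewrite /lag /time !big_pred0.
have {IHj} [[i lei] IHj] := IHj (ltnW jn).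
pose k := Ordinal jn.
have timek i' : time u X M i' j.+1 =
    time u X M i' j + inv_speed u (M i' k) * X 0 k.
  by rewrite timeS (big_pred1 k).
have lagk : lag j.+1 = lag j + (if used k then u b else u 1%N) * X 0 k.
  rewrite /lag (bigD1 k) //= addrC; congr (_ + _); apply: eq_bigl => l.
  by rewrite -(inj_eq val_inj) /=; nlia.
have user i' : M i' k = ord_max -> lag j.+1 <= time u X M i' j.+1.
  move=> i'b; have usedk : used k by apply/existsP; exists i'; apply/eqP.
  rewrite lagk timek usedk i'b; apply: lerD; last first.
    by rewrite /inv_speed /= ifF //; nlia.
  have [j0|j0] := posnP j.
    by rewrite /lag /time j0 !big_pred0.
  have jn' : (j.-1 < n)%N by nlia.
  have kE : k = (Ordinal jn').+1 :> nat by rewrite /= prednK.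
  have b0 : M i' k != ord0.
    by rewrite i'b -(inj_eq val_inj) /=; nlia.
  have [i'' i''b] := avail i' k (Ordinal jn') kE b0.
  apply: le_trans (ontime i' i'' k (Ordinal jn') kE (esym i''b) b0).
  by apply: (IHj i'' (Ordinal jn')); rewrite ?i''b //= prednK.
split; last first.
  move=> i' k' [jk']; rewrite (_ : k' = k); last exact/val_inj.
  exact: user.
(* If bike [b] is idle here, [lag] grows at the pace [u 1], which no agent beats, so the previous
   witness still serves. *)
have [/existsP[i' /eqP /user ?]|unused] := boolP (used k); first by exists i'.
exists i; rewrite lagk timek (negbTE unused) lerD // ler_wpM2r //.
exact: inv_speed_ge.
Qed.

Lemma tau_ge_T1_objective : feasible u X M ->
  exists2 y, 0 <= y <= 1 & T1_objective m b u y <= tau u X M.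
Proof.
move=> feas; have [[X0 X1] avail notshared ontime] := feas.
pose used j := [exists i, M i j == ord_max].
(* The total length on which bike [b] is ridden. *)
pose y := \sum_j (used j)%:R * X 0 j.
exists y.
  apply/andP; split; first by apply: sumr_ge0 => j _; rewrite mulr_ge0 ?ler0n.
  rewrite -X1; apply: ler_sum => j _; rewrite ler_piMl // lern1; exact: leq_b1.
have m0 : 0 < m%:R :> R by rewrite ltr0n; nlia.
rewrite /T1_objective ge_max; apply/andP; split.
  rewrite -(ler_pM2l m0) /TY big_nat_recr /=; last by nlia.
  rewrite eqxx (eq_big_nat _ _ (F2 := fun k => 1 - u k)) => [|k kb]; last first.
    by rewrite ifF ?mulr1 //; nlia.
  rewrite mulrBr mulr1 mulrA divff ?gt_eqF // mul1r.
  have : \sum_(i < m) arrival u X M i <= m%:R * tau u X M.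
    rewrite (_ : _ * _ = \sum_(i < m) tau u X M); last first.
      by rewrite sumr_const card_ord mulr_natl.
    by apply: ler_sum => i _; exact: arrival_le_tau.
  apply: le_trans; rewrite (eq_bigr _ (fun i _ => arrivalE i)) exchange_big /=.
  set V := \sum_(1 <= k < b) (1 - u k).
  apply: (@le_trans _ _
    (\sum_j (m%:R - V - (used j)%:R * (1 - u b)) * X 0 j)).
    rewrite [leRHS](eq_bigr (fun j =>
      (m%:R - V) * X 0 j - (1 - u b) * ((used j)%:R * X 0 j))); last first.
      by move=> j _; ring.
    by rewrite [leRHS]sumrB -!mulr_sumr X1 mulr1 -/y; lra.
  apply: ler_sum => j _; rewrite -mulr_suml ler_wpM2r //.
  exact: column_pace.
have [[i le_i] _] := bike_b_schedule feas (leqnn n).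
apply: le_trans (arrival_le_tau i); apply: le_trans le_i.
rewrite [leRHS](eq_bigr (fun j =>
  (used j)%:R * X 0 j * (u b - u 1%N) + u 1%N * X 0 j)); last first.
  by move=> j _; rewrite /used; case: existsP => _ /=; ring.
rewrite (eq_bigl xpredT) => [|j]; last by rewrite ltn_ord.
by rewrite big_split /= -mulr_suml -mulr_sumr X1 -/y; lra.
Qed.

End LowerBound.

(** * From trips to feasible points of the linear program *)

Section Columns.
Variables (R : realType) (u : nat -> R) (m b : nat) (cs : seq (nat -> nat)).

Definition column_matrix : 'M['I_b.+1]_(m, size cs) :=
  \matrix_(i, j) inord (nth (fun=> 0%N) cs j i.+1).

(** The lengths chosen column by column are gathered into one function. In [p :: cs] the entry [j]
    is the column that precedes column [j]. *)
Lemma trip_lengths p s L s' : trip u m p s cs L s' ->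
  let c0 := fun=> 0%N in
  exists x : nat -> R,
  let st j i := s i + \sum_(0 <= k < j) x k * inv_speed u (nth c0 cs k i) in
  [/\ forall j, 0 <= x j, \sum_(0 <= j < size cs) x j = L,
      forall j, (j < size cs)%N ->
        handover m (nth c0 (p :: cs) j) (nth c0 cs j) (st j)
    & forall i, (0 < i <= m)%N -> st (size cs) i = s' i].
Proof.
move=> + c0; elim: cs p s L => [|c cs' IHcs] p s L /=.
  move=> [-> ss]; exists (fun=> 0); split=> //; first by rewrite big_geq.
  by move=> i im; rewrite big_geq // addr0 ss.
move=> [x [x0 pc /IHcs[z [z0 zL zc zs]]]].
exists (fun j => if j is j'.+1 then z j' else x); split.
- by case.
- by rewrite big_nat_recl //= zL subrKC.
- case=> [_ | j jcs] i i' im i'm ci ci0.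
    by rewrite !big_geq // !addr0 (pc i).
  by rewrite !big_nat_recl //= !addrA; exact: (zc j).
- by move=> i im; rewrite big_nat_recl //= addrA; exact: zs.
Qed.

Hypothesis labels_le :
  forall j i, (j < size cs)%N -> (0 < i <= m)%N ->
    (nth (fun=> 0%N) cs j i <= b)%N.

Lemma column_matrixE i j :
  column_matrix i j = nth (fun=> 0%N) cs j i.+1 :> nat.
Proof.
rewrite mxE inordK // ltnS labels_le //; have := ltn_ord i; nlia.
Qed.

Lemma trip_lp_feasible t :
  trip u m (fun=> 0%N) (fun=> 0) cs 1 (fun=> t) ->
  exists X, lp_feasible u column_matrix t X.
Proof.
move=> /trip_lengths[x [x0 x1 xc xt]].
have ME := column_matrixE.
pose X : 'rV[R]_(size cs) := \row_j x j.
have timeE i j : (j <= size cs)%N -> time u X column_matrix i j =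
    \sum_(0 <= k < j) x k * inv_speed u (nth (fun=> 0%N) cs k i.+1).
  move=> jcs; rewrite big_mkord (big_ord_widen (size cs) (fun k =>
    x k * inv_speed u (nth (fun=> 0%N) cs k i.+1))) //.
  by apply: eq_bigr => k _; rewrite ME mxE mulrC.
exists X; split.
- move=> i; rewrite /arrival timeE // -[leLHS]add0r xt //.
  by have := ltn_ord i; nlia.
- move=> i i' j j' jj' Mij Mij0 _; rewrite !timeE 1?ltnW //.
  have := xc j (ltn_ord j) i.+1 i'.+1; rewrite !add0r.
  rewrite (_ : nth _ (_ :: cs) j = nth (fun=> 0%N) cs j'); last by rewrite jj'.
  rewrite -!ME; apply.
  + by have := ltn_ord i; nlia.
  + by have := ltn_ord i'; nlia.
  + by rewrite Mij.
  + exact: Mij0.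
- by move=> j; rewrite mxE.
- by rewrite -x1 big_mkord; apply: eq_bigr => j _; rewrite mxE.
Qed.

(** The set of ridden bikes only shrinks along the columns, so a bike in use was also ridden just
    before. Two lists serve AllButOne, which abandons bike [b] after block 1. *)
Lemma column_matrix_available ls ls' cs1 cs2 : cs = cs1 ++ cs2 ->
  {subset ls' <= ls} ->
  all (rides m ^~ ls) cs1 -> all (rides m ^~ ls') cs2 ->
  bikes_available column_matrix.
Proof.
move=> csE ls'ls /all_nthP ls1 /all_nthP ls2 i j j' jj' Mij0.
have sj : (j < size cs1 + size cs2)%N by rewrite -size_cat -csE ltn_ord.
have nthE k : nth (fun=> 0%N) cs k = nth (fun=> 0%N) (cs1 ++ cs2) k.
  by rewrite csE.
have im : (0 < i.+1 <= m)%N by have := ltn_ord i; nlia.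
set l := nth (fun=> 0%N) cs j i.+1.
have l0 : l != 0%N by rewrite /l -column_matrixE; exact: Mij0.
suff [k km kl] : exists2 k, (0 < k <= m)%N & nth (fun=> 0%N) cs j' k = l.
  have k1m : (k.-1 < m)%N by nlia.
  exists (Ordinal k1m); apply: val_inj; rewrite /= !column_matrixE /= -/l -kl.
  by rewrite prednK //; nlia.
move: l0; rewrite /l !nthE !nth_cat; case: ltnP => j1 l0.
  rewrite ifT; last by nlia.
  apply: rides_ex (ls1 _ j'  _) _; first by nlia.
  by apply: rides_mem (ls1 _ j j1) im l0.
have ll' := rides_mem (ls2 (fun=> 0%N) (j - size cs1)%N _) im l0.
case: ltnP => j'1.
  by apply: rides_ex (ls1 _ j' j'1) _; apply/ls'ls/ll'; nlia.
by apply: rides_ex (ls2 _ (j' - size cs1)%N _) _; [nlia | apply: ll'; nlia].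
Qed.

Lemma column_matrix_not_shared :
  (forall j, (j < size cs)%N ->
    exists2 ls, uniq ls & rides m (nth (fun=> 0%N) cs j) ls) ->
  bikes_not_shared column_matrix.
Proof.
move=> csls i i' j Mij0; apply: contraNneq => /(congr1 val) /=.
have [ls lsU jls] := csls j (ltn_ord j); rewrite !column_matrixE => ii'.
apply/eqP/val_inj/succn_inj; apply: (rides_inj jls lsU) => //.
- exact: ltn_ord i'.
- exact: ltn_ord i.
- by rewrite [X in X != _]ii' -column_matrixE; exact: Mij0.
Qed.

End Columns.

(** The handover condition is trivial for [i = i']. Having an agent and nonnegative paces gives
    [0 <= t], which the default value in [tau] calls for. *)
Lemma lp_feasible_schedule (R : realType) (u : nat -> R) (m b n : nat)
    (M : 'M['I_b.+1]_(m, n)) t X :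
  (0 < m)%N -> (forall l : 'I_b.+1, 0 <= inv_speed u l) ->
  bikes_available M -> bikes_not_shared M -> lp_feasible u M t X ->
  feasible u X M /\ tau u X M <= t.
Proof.
move=> m0 u0 avail notshared [Xt ontime X0 X1]; split.
  split=> // i i' j j' jj' Mij Mij0; have [<- //|ii'] := eqVneq i i'.
  exact: ontime jj' Mij Mij0 ii'.
apply/bigmax_leP; split=> [|i _]; last exact: Xt.
apply: le_trans (Xt (Ordinal m0)); apply: sumr_ge0 => k _.
by rewrite mulr_ge0.
Qed.
Lemma total_pace0E (R : realType) (u : nat -> R) m b :
  (0 < m)%N -> m%:R * T m b u = total_pace u 0 m b.
Proof.
move=> m0; rewrite /T /total_pace /load /index_iota mulrBr mulr1 mulrA.
by rewrite subSS subn0 divff ?mul1r // pnatr_eq0 -lt0n.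
Qed.

(** * The trip of AllButOne *)

Section AllButOneTrip.
Variables (R : realType) (u : nat -> R) (n b q : nat) (y : R).
Hypothesis qb : (0 < q < b)%N.
Hypothesis u01 : forall k, (1 <= k <= b)%N -> 0 < u k < 1.
Hypothesis u_sorted : forall j k, (1 <= j <= k)%N -> (k <= b)%N -> u j <= u k.
Hypothesis y01 : 0 <= y <= 1.
Let t : R := y * u b + (1 - y) * u 1%N.
Let m := (n + b)%N.
Let group := (n + q)%N.
Let d i := if (i < m)%N then (i - n)%N else 1%N.
Let block h := all_make_it 1 h (h - n - 1).
Hypothesis group_fast : group%:R * u q <= total_pace u 0 group q.
Hypothesis group_slow : total_pace u 0 group q <= group%:R * u q.+1.
Hypothesis t_mean :
  m%:R * t = m%:R - \sum_(1 <= k < b) (1 - u k) - y * (1 - u b).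
Hypothesis ub_le : u (b - 1)%N <= t.

Let cols1 :=
  [seq stack group c (fun i => (i - n)%N) | c <- all_make_it 0 group q].
Let cols2 := flatten
  [seq [seq stack h c d | c <- block h] | h <- iota group (b - q)].

Let d_inj i j : (group < i <= m)%N -> (group < j <= m)%N -> d i = d j -> i = j.
Proof. by rewrite /d /group /m => im jm; do 2 case: ifP; nlia. Qed.

(** After block 1, of length [y], [catch_up] applies with bike 1 given to agent [m] in place of bike
    [b]. Agents below the group who keep to their bikes would end at [u q.+1], ..., [u (b - 1)] and,
    for agent [m], at [t]. *)
Lemma all_but_one_trip :
  trip u m (fun=> 0%N) (fun=> 0) (cols1 ++ cols2) 1 (fun=> t).
Proof.
have /andP[y0 y1] := y01.
have g0 : (0 < group)%N by rewrite /group; nlia.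
have g0' : 0 < group%:R :> R by rewrite ltr0n.
set v := total_pace u 0 group q / group%:R.
have gv : group%:R * v = total_pace u 0 group q.
  by rewrite mulrC divfK // gt_eqF.
(* [A] and [B] are the total paces of agents 1, ..., [m - 1] and of the group once bike 1 has gone
   to agent [m]. *)
pose A := total_pace u 1 (n.+1 + (b - 2)) (b - 2).
pose B := total_pace u 1 (n.+1 + (q - 1)) (q - 1).
have loadS k : (0 < k)%N ->
    load u (iota 1 k) = (1 - u 1%N) + load u (iota 2 (k - 1)).
  by case: k => // k _; rewrite /load big_cons subSS subn0.
have gB : group%:R * v = B - (1 - u 1%N).
  rewrite gv /B /total_pace loadS; last by nlia.
  by rewrite (_ : (n.+1 + (q - 1))%N = group) /group; [ring | nlia].
have tA : m%:R * t = A + 1 - (1 - u 1%N) - y * (1 - u b).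
  rewrite t_mean (_ : \sum_(1 <= k < b) (1 - u k) = load u (iota 1 (b - 1))) //.
  rewrite loadS; last by nlia.
  rewrite /A /total_pace (_ : m = (n.+1 + (b - 2)).+1); last first.
    by rewrite /m; nlia.
  by rewrite -natr1 -subnDA; ring.
have AB : A = B + \sum_(group.+1 <= i < m) u (i - n)%N.
  rewrite /A /B (@total_pace_sum _ u 1 n.+1 (b - 2) (q - 1)); last by nlia.
  congr (_ + _); rewrite (_ : (n.+1 + (q - 1))%N = group); last first.
    by rewrite /group; nlia.
  rewrite (_ : (n.+1 + (b - 2)).+1 = m); last by rewrite /m; nlia.
  by apply: eq_big_nat => i im; congr u; rewrite /group in im; nlia.
pose S i := if (i <= group)%N then 0 + y * v else 0 + y * inv_speed u (i - n).
have ui i : (group < i <= m)%N -> inv_speed u (i - n) = u (i - n)%N.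
  by move=> im; rewrite /inv_speed ifF //; rewrite /group in im; nlia.
have Sg i : (0 < i <= group)%N -> S i = y * v.
  by move=> /andP[_ ig]; rewrite /S ig add0r.
have Si i : (group < i <= m)%N -> S i = y * u (i - n)%N.
  by move=> im; rewrite /S ifF ?ui ?add0r //; nlia.
have gm : (group < m)%N by rewrite /group /m; nlia.
have gS : S group.+1 = y * u q.+1.
  rewrite Si; last by nlia.
  by rewrite /group -addnS addKn.
have vS : y * v <= S group.+1.
  by rewrite gS ler_wpM2l // /v ler_pdivrMr // mulrC.
have SS i : (group < i < m)%N -> S i <= S i.+1.
  move=> im; rewrite !Si; [|nlia..]; rewrite ler_wpM2l // u_sorted //.
    by rewrite /group in im; nlia.
  by rewrite /m in im; nlia.
have tr1 : trip u m (fun=> 0%N) (fun=> 0) cols1 y S.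
  apply: (@trip_block _ u m group _ (fun=> 0) _ y 0 v (fun i => (i - n)%N)
    (iota 1 q)) => //.
  - exact: ltnW.
  - rewrite map_inj_in_uniq ?iota_uniq // => i j.
    by rewrite !mem_iota /group; nlia.
  - by move=> i; rewrite mem_iota /group; nlia.
  - by apply: all_make_it_rides; rewrite /group; nlia.
  - by move=> c _; exact: handover0.
  - by apply: (all_make_it_trip u01 u_sorted) => //; rewrite /group; nlia.
have dm : d m = 1%N by rewrite /d ltnn.
have di i : (i < m)%N -> d i = (i - n)%N by rewrite /d => ->.
pose e i := S i + (1 - y) * inv_speed u (d i).
have em : e m = t.
  rewrite /e dm Si; last by nlia.
  by rewrite /t (_ : (m - n)%N = b) //; rewrite /m; nlia.
have ei i : (group < i < m)%N -> e i = u (i - n)%N.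
  by move=> im; rewrite /e di ?ui ?Si; [ring | nlia..].
rewrite -[X in trip _ _ _ _ _ X](subrKC y); apply: (trip_cat tr1).
rewrite -em /cols2.
have [r rE] : exists r, (b - q)%N = r.+1 by exists (b - q).-1; nlia.
rewrite rE.
apply: (@catch_up _ u r group m _ S (1 - y) (y * v) block
  (fun h => iota 2 (h - n - 1)) (fun h => total_pace u 1 h (h - n - 1))
  d) => //.
- by rewrite /m /group; nlia.
- by rewrite subr_ge0.
- rewrite map_inj_in_uniq ?iota_uniq // => i j; rewrite !mem_iota => im jm.
  by apply: d_inj; nlia.
- by move=> i im; rewrite /d; case: ifP; rewrite /group in im; nlia.
- move=> h i hi im; rewrite mem_iota /d.
  by case: ifP; rewrite /group in hi; nlia.
- move=> h hm; rewrite /group /m in hm; split; first exact: all_make_it_neq0.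
    by apply: all_make_it_rides; nlia.
  apply: (all_make_it_trip u01 u_sorted); [nlia.. | move=> h0].
  have := @total_pace_ge _ u b u_sorted 1 n.+1 (b - 2) (h - n - 1).
  rewrite (_ : (n.+1 + (h - n - 1))%N = h); last by nlia.
  apply; [nlia.. |].
  rewrite (_ : (1 + (b - 2))%N = (b - 1)%N); last by nlia.
  have : (n.+1 + (b - 2))%:R = m%:R - 1 :> R.
    by rewrite (_ : m = (n.+1 + (b - 2)).+1) -?natr1 ?addrK // /m; nlia.
  rewrite -/A => ->; have u1 : 0 < u 1%N < 1 by apply: u01; nlia.
  have : 1 <= m%:R :> R by rewrite ler1n /m; nlia.
  (* This is [A - (m - 1) * t]; with [u (b - 1) <= t] it yields the condition for AllMakeIt on bikes
     2, ..., [b - 1]. *)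
  have : 0 <= y * (1 - u 1%N) by apply: mulr_ge0; lra.
  by move: tA ub_le; rewrite /t; nra.
- move=> h gh hm; rewrite /group /m in gh hm.
  rewrite (_ : (h.+1 - n - 1)%N = (h - n - 1).+1); last by nlia.
  rewrite total_paceS di ?ui; [|rewrite /m /group; nlia..].
  by congr (_ + u _); nlia.
- move=> i im; rewrite -/(e i) -/(e i.+1) ei //.
  (* Agent [m] may join last because [u (b - 1) <= t]. *)
  have [iE|im'] := eqVneq i.+1 m.
    by rewrite iE em (_ : (i - n)%N = (b - 1)%N) //; rewrite /m in iE; nlia.
  rewrite ei; last by nlia.
  by apply: u_sorted; rewrite /group /m in im; nlia.
- rewrite -/(e m) em big_nat_recr /=; last by rewrite /m /group; nlia.
  rewrite (eq_big_nat _ _ (F2 := fun i => u (i - n)%N)) => [|i]; last exact: ei.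
  rewrite -/(e m) em tA AB (_ : total_pace _ _ _ _ = B); last first.
    rewrite /B (_ : (n.+1 + (q - 1))%N = group) /group; last by nlia.
    by congr total_pace; nlia.
  by rewrite /t mulrCA gB; ring.
move=> c' c'ls.
have all1 : all (rides group ^~ (iota 1 q)) (all_make_it 0 group q).
  by apply: all_make_it_rides; rewrite /group; nlia.
have [c0 _ ->] := last_stack (fun=> 0%N) (fun i => (i - n)%N)
  (@all_make_it_neq0 0 group q) all1.
apply: (handover_synced c'ls).
- move=> i i' im i'g; rewrite [S i']Sg //.
  have [ig|gi] := leqP i group; first by rewrite Sg //; nlia.
  by apply: le_trans vS _; apply: (homo_range SS); nlia.
- move=> i' im; rewrite /group in im; rewrite /stack ifF ?mem_iota /group.
    by nlia.
  by nlia.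
- move=> i i' im i'm; rewrite /stack [X in if X then _ else _]leqNgt.
  rewrite (_ : (group < i')%N) /=; last by nlia.
  by rewrite /d; case: ifP; rewrite /group in im i'm; nlia.
Qed.

End AllButOneTrip.

(** * Bikes ridden in the columns of AllButOne, and the index [q] *)

Lemma all_but_one_rides1 n b q : (0 < q < b)%N ->
  all (rides (n + b) ^~ (iota 1 b))
    [seq stack (n + q) c (fun i => (i - n)%N) | c <- all_make_it 0 (n + q) q].
Proof.
move=> qb; rewrite all_map.
apply: sub_all (@all_make_it_rides 0 (n + q) q _) => [c cq /=|]; last by nlia.
have -> : iota 1 b = iota 1 q ++ [seq (i - n)%N | i <- iota (n + q).+1 (b - q)].
  by rewrite (@map_iota_shift 0 n q (b - q)) -iotaD subnKC //; nlia.
rewrite (_ : (n + b)%N = (n + q + (b - q))%N); last by nlia.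
by apply: rides_stack cq _ => i; nlia.
Qed.

(** Agent [m] has left bike [b] for bike 1, so the label 1 comes last in the column and is moved to
    the front by a permutation. *)
Lemma all_but_one_rides2 n b q : (0 < q < b)%N ->
  all (rides (n + b) ^~ (iota 1 (b - 1))) (flatten
    [seq [seq stack h c (fun i => if (i < n + b)%N then (i - n)%N else 1%N)
         | c <- all_make_it 1 h (h - n - 1)] | h <- iota (n + q) (b - q)]).
Proof.
move=> qb; rewrite all_flatten all_map.
apply/allP => h; rewrite mem_iota => hb /=; rewrite all_map.
apply: sub_all (@all_make_it_rides 1 h (h - n - 1) _) => [c ch /=|]; [|nlia].
set d := fun i => _; have d0 i : (h < i <= h + (n + b - h))%N -> d i != 0%N.
  by move=> ih; rewrite /d; case: ifP; nlia.
have := rides_stack ch d0; rewrite subnKC; last by nlia.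
move=> /perm_trans; apply.
rewrite (_ : n + b - h = (n + b - h - 1) + 1)%N; last by nlia.
rewrite iotaD map_cat /=.
have -> : [seq d i | i <- iota h.+1 (n + b - h - 1)] =
    iota (h - n).+1 (n + b - h - 1).
  have := map_iota_shift 0 n (h - n) (n + b - h - 1).
  rewrite add0n subnKC => [<-|]; last by nlia.
  apply/eq_in_map => i.
  by rewrite mem_iota /d => ih; rewrite ifT //; nlia.
rewrite (_ : d _ = 1%N); last by rewrite /d ifF //; nlia.
rewrite catA -[(h - n).+1]/(1 + (h - n))%N.
rewrite (_ : (1 + (h - n))%N = (2 + (h - n - 1))%N); last by nlia.
rewrite -iotaD perm_catC /=.
by rewrite (_ : (b - 1)%N = (h - n - 1 + (n + b - h - 1)).+1) //; nlia.
Qed.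

(** Block [j >= 2] is reindexed by its group size [h = n + q + j - 2], the form used by
    [catch_up]. *)
Lemma abo_columnsE (R : realType) (u : nat -> R) n b :
  (0 < abo_index (n + b) b u)%N ->
  let q := abo_index (n + b) b u in
  abo_columns (n + b) b u =
  [seq stack (n + q) c (fun i => (i - n)%N) | c <- all_make_it 0 (n + q) q] ++
  flatten
    [seq [seq stack h c (fun i => if (i < n + b)%N then (i - n)%N else 1%N)
         | c <- all_make_it 1 h (h - n - 1)] | h <- iota (n + q) (b - q)].
Proof.
rewrite /abo_columns; set q := abo_index _ _ _ => q0 /=; rewrite addnK.
congr (_ ++ flatten _).
rewrite (iotaDl 2 0) -[(n + q)%N]addn0 (iotaDl (n + q) 0) -!map_comp.
apply/eq_in_map => i _ /=.
rewrite (_ : (n + (q + (2 + i) - 2))%N = (n + q + i)%N); last by nlia.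
by rewrite (_ : (q + (2 + i) - 3)%N = (n + q + i - n - 1)%N) //; nlia.
Qed.

(** The witness [k] excludes the default value 0, so the maximum is attained at a qualifying
    index. *)
Lemma abo_indexP (R : realType) (u : nat -> R) m b k :
  let q := abo_index m b u in
  (0 < k <= b)%N -> u k <= T (m - b + k) k u ->
  [/\ (k <= q)%N, (q <= b)%N, u q <= T (m - b + q) q u &
    forall j, (q < j <= b)%N -> T (m - b + j) j u < u j].
Proof.
rewrite /abo_index; pose P j := u j <= T (m - b + j)%N j u.
set q := (\max_(_ <= j < _ | _) _)%N.
have le_q j : (0 < j <= b)%N -> P j -> (j <= q)%N.
  move=> jb Pj; apply: (@leq_bigmax_seq _ _ P id) => //.
  by rewrite mem_index_iota; nlia.
move=> kb Pk; have kq := le_q k kb Pk.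
have /orP[/eqP q0|/andP[qb Pq]] : (q == 0%N) || (0 < q <= b)%N && P q.
  rewrite /q big_nat_cond; elim/big_ind: _ => //.
  - by move=> x y Px Py; rewrite /maxn; case: ifP.
  - by move=> j /andP[jb Pj]; apply/orP; right; apply/andP; split=> //; nlia.
- by nlia.
split=> // [|j jb]; first by nlia.
by rewrite ltNge; apply/negP => Pj; have := le_q j _ Pj; nlia.
Qed.

(** * Optimality of the AllButOne schedule *)

Theorem theorem12 (R : realType) (m b : nat) (u : nat -> R) (t1 : R)
    (hbm : (1 <= b <= m)%N)
    (hu01 : forall k : nat, (1 <= k <= b)%N -> 0 < u k < 1)
    (hsorted : forall j k : nat, (1 <= j <= k)%N -> (k <= b)%N -> u j <= u k)
    (hub : T m b u < u b)
    (ht1 : is_T1 m b u t1)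
    (hub1 : u (b - 1)%N <= t1) :
  (exists X, abo_output m b u X) /\
  (forall X, abo_output m b u X ->
     feasible u X (abo_matrix m b u) /\
     forall (n' : nat) (X' : 'rV[R]_n') (M' : 'M['I_b.+1]_(m, n')),
       feasible u X' M' -> tau u X (abo_matrix m b u) <= tau u X' M').
Proof.
have u1 : 0 < u 1%N < 1 by apply: hu01; nlia.
have m0 : (0 < m)%N by nlia.
have m0' : 0 < m%:R :> R by rewrite ltr0n.
pose V := m%:R^-1 * \sum_(1 <= k < b) (1 - u k).
pose v := m%:R^-1 * (1 - u b).
have v0 : 0 <= v.
  have ub : 0 < u b < 1 by apply: hu01; nlia.
  by rewrite mulr_ge0 ?invr_ge0 //; lra.
have TYE y : TY m b u (fun k => if k == b then y else 1) = 1 - V - v * y.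
  rewrite /TY big_nat_recr /=; last by nlia.
  rewrite eqxx (eq_big_nat _ _ (F2 := fun k => 1 - u k)) => [|k kb]; last first.
    by rewrite ifF ?mulr1 //; nlia.
  by rewrite /V /v; ring.
have TE : T m b u = 1 - V - v.
  by rewrite /T big_nat_recr /=; [rewrite /V /v; ring | nlia].
have V1 : V <= 1 - u 1%N.
  rewrite /V mulrC ler_pdivrMr //.
  apply: (@le_trans _ _ (\sum_(1 <= k < b) (1 - u 1%N))).
    by apply: ler_sum_nat => k kb; rewrite lerB // hsorted //; nlia.
  rewrite sumr_const_nat -[leLHS]mulr_natr ler_wpM2l ?ler_nat //; first by lra.
  by nlia.
(* The two expressions of the objective cross: at 0 the mean bound is at least [u 1] because
   [V <= 1 - u 1], and at 1 it is below [u b] by [hub]. *)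
have [y y01 yE] : exists2 y, 0 <= y <= 1 &
    u 1%N + y * (u b - u 1%N) = 1 - V + y * - v.
  by apply: affine_meet; lra.
have /andP[y0 y1] := y01.
pose t := y * u b + (1 - y) * u 1%N.
have tE : t = 1 - V - v * y by rewrite /t; lra.
have ub_u1 : u 1%N <= u b by apply: hsorted; nlia.
(* One expression is nonincreasing and the other nondecreasing, so their common value minimizes the
   maximum. *)
have t_le z : 0 <= z <= 1 -> t <= T1_objective m b u z.
  move=> /andP[z0 z1]; rewrite /T1_objective le_max TYE.
  have [zy|/ltW yz] := leP z y; apply/orP; first by left; rewrite tE; nra.
  by right; rewrite /t; nra.
have t_obj : T1_objective m b u y = t by rewrite /T1_objective TYE -tE maxxx.
have ub1_t : u (b - 1)%N <= t.
  by apply: le_trans hub1 _; rewrite -t_obj; apply: ht1.2.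
have t_opt n' (X' : 'rV[R]_n') (M' : 'M['I_b.+1]_(m, n')) :
    feasible u X' M' -> t <= tau u X' M'.
  move=> /(tau_ge_T1_objective hbm hu01 hsorted)[z z01]; apply: le_trans.
  exact: t_le.
have t_mean : m%:R * t = m%:R - \sum_(1 <= k < b) (1 - u k) - y * (1 - u b).
  by rewrite tE /V /v; field; rewrite gt_eqF.
have [n mE] : exists n, m = (n + b)%N by exists (m - b)%N; nlia.
subst m; have mT k : (0 < k)%N ->
    (n + k)%:R * T (n + b - b + k) k u = total_pace u 0 (n + k) k.
  by move=> k0; rewrite addnK; apply: total_pace0E; nlia.
have gt0 k : (0 < k)%N -> 0 < (n + k)%:R :> R by move=> k0; rewrite ltr0n; nlia.
have P1 : u 1%N <= T (n + b - b + 1) 1 u.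
  rewrite -(ler_pM2l (gt0 1%N isT)) mT // addn1 total_paceS /total_pace.
  rewrite /load big_nil subr0 -natr1 mulrDl mul1r lerD2r.
  by rewrite ler_piMr ?ler0n //; lra.
have b1 : (0 < 1 <= b)%N by nlia.
have [q0 qb uq qS] := abo_indexP b1 P1.
set q := abo_index (n + b) b u in q0 qb uq qS.
(* The case [q = b] would contradict [hub]. *)
have {}qb : (0 < q < b)%N.
  rewrite q0 ltn_neqAle qb andbT; apply/eqP => qb'.
  by move: uq hub; rewrite qb' addnK leNgt => /negP.
have group_fast : (n + q)%:R * u q <= total_pace u 0 (n + q) q.
  by rewrite -mT // ler_pM2l // gt0.
(* By maximality of [q], bike [q + 1] is slower than the mean of [n + q + 1] agents; removing it
   with its rider leaves the claim. *)
have group_slow : total_pace u 0 (n + q) q <= (n + q)%:R * u q.+1.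
  have := qS q.+1; rewrite -(ltr_pM2l (gt0 q.+1 isT)) mT // addnS total_paceS.
  rewrite -natr1 mulrDl mul1r ltrD2r => /(_ _)/ltW; apply; nlia.
have rides1 := all_but_one_rides1 n qb; have rides2 := all_but_one_rides2 n qb.
have csE := @abo_columnsE R u n b q0.
have tr :=
  all_but_one_trip qb hu01 hsorted y01 group_fast group_slow t_mean ub1_t.
rewrite -csE in tr.
have sub_b : {subset iota 1 (b - 1) <= iota 1 b}.
  by move=> l; rewrite !mem_iota; nlia.
have col j : (j < size (abo_columns (n + b) b u))%N ->
    exists ls, [/\ uniq ls, {subset ls <= iota 1 b}
      & rides (n + b) (nth (fun=> 0%N) (abo_columns (n + b) b u) j) ls].
  move/all_nthP: rides1 => rides1; move/all_nthP: rides2 => rides2.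
  rewrite csE size_cat nth_cat -/q => j2; case: ltnP => j1.
    by exists (iota 1 b); split; rewrite ?iota_uniq //; exact: rides1.
  by exists (iota 1 (b - 1)); split; rewrite ?iota_uniq //; apply: rides2; nlia.
have labels j i :
    (j < size (abo_columns (n + b) b u))%N -> (0 < i <= n + b)%N ->
    (nth (fun=> 0%N) (abo_columns (n + b) b u) j i <= b)%N.
  move=> /col[ls [_ lsb jls]] im.
  set l := nth _ _ _ _; have [-> // | l0] := eqVneq l 0%N.
  by have /lsb := rides_mem jls im l0; rewrite mem_iota; nlia.
have avail := column_matrix_available labels csE sub_b rides1 rides2.
have notshared : bikes_not_shared (abo_matrix (n + b) b u).
  apply: (column_matrix_not_shared labels) => j /col[ls [lsU _ jls]].
  by exists ls.
have [X0 X0t] := trip_lp_feasible labels tr.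
have lp_schedule t' X : lp_feasible u (abo_matrix (n + b) b u) t' X ->
    feasible u X (abo_matrix (n + b) b u) /\
    tau u X (abo_matrix (n + b) b u) <= t'.
  apply: lp_feasible_schedule => // l.
  exact/ltW/(inv_speed_gt0 hbm hu01 hsorted).
split.
  (* Every feasible point of the linear program is a feasible schedule, so the lower bound [t] makes
     [X0] optimal. *)
  exists X0, t; split=> // t' X /lp_schedule[feas]; apply: le_trans.
  exact: t_opt.
move=> X [t' [lpX t'_opt]]; have [feas tau_le] := lp_schedule _ _ lpX.
split=> // n' X' M' /t_opt; apply: le_trans.
exact: le_trans tau_le (t'_opt _ _ X0t).
Qed.
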